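(* There exist a universal constant $C>0$ and an integer $n_0$ such that for every integer $n>n_0$ and every integer $t$ with $n-2\le t\le \frac{n^2}{2}-Cn\log n$, there exists an $(n,t)$-blocker, i.e. a saturated blocker for triangulations of a convex $n$-gon consisting of exactly $t$ edges.
   Context: Let $P$ be a convex polygon with $n$ vertices labeled $0,1,\dots,n-1$ in cyclic order (indices modulo $n$). An edge $(i,j)$ is the segment between vertices $i$ and $j$; boundary edges are $(i,i+1)$, and diagonals are the other edges. Two edges cross if they share an interior point. A triangulation of $P$ is a maximal set of pairwise non-crossing diagonals of $P$. A blocker (for triangulations) is a set $B$ of diagonals having at least one diagonal in common with every triangulation of $P$. A blocker $B$ is saturated if for every $e\in B$ the set $B\setminus\{e\}$ is not a blocker. An $(n,k)$-blocker is a saturated blocker of size $k$ for a convex $n$-gon. *)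

(* Defs.v *)
From mathcomp Require Import all_boot.
From Stdlib Require Import Reals.

Set Implicit Arguments.
Unset Strict Implicit.
Unset Printing Implicit Defensive.

(* Vertices of the convex n-gon: 'I_n in cyclic order.
   An edge {i,j} is represented by the ordered pair (i,j) with i < j. *)
Definition edge (n : nat) := ('I_n * 'I_n)%type.

Definition is_diag (n : nat) (e : edge n) : bool :=
  [&& (e.1 < e.2)%N, (e.1.+1 < e.2)%N & ~~ ((val e.1 == 0%N) && (val e.2 == n.-1))].

Definition diagonals (n : nat) : {set edge n} := [set e | is_diag e].

(* Two diagonals of a convex polygon share an interior point iff their
   endpoints strictly interleave along the boundary. *)
Definition cross (n : nat) (e f : edge n) : bool :=
  [|| [&& (e.1 < f.1)%N, (f.1 < e.2)%N & (e.2 < f.2)%N]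
    | [&& (f.1 < e.1)%N, (e.1 < f.2)%N & (f.2 < e.2)%N] ].

Definition noncrossing (n : nat) (T : {set edge n}) : Prop :=
  forall e f, e \in T -> f \in T -> ~~ cross e f.

Definition triangulation (n : nat) (T : {set edge n}) : Prop :=
  T \subset diagonals n /\ noncrossing T /\
  (forall e, e \in diagonals n -> e \notin T -> exists2 f, f \in T & cross e f).

Definition blocker (n : nat) (B : {set edge n}) : Prop :=
  B \subset diagonals n /\
  (forall T, triangulation T -> exists2 e, e \in B & e \in T).

Definition saturated_blocker (n : nat) (B : {set edge n}) : Prop :=
  blocker B /\ (forall e, e \in B -> ~ blocker (B :\ e)).

Definition nk_blocker (n : nat) (k : nat) (B : {set edge n}) : Prop :=
  saturated_blocker B /\ #|B| = k.

(* Main.v *)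
From Stdlib Require Import Reals Classical Lra.
Require Import Defs.
From mathcomp Require Import all_boot zify.

(** A chord set contains no triangulation as soon as its chords, and the
    boundary edges clockwise, can be oriented without a directed triangle:
    walking through a triangulation from the root edge, one never gets stuck.
    Conversely, if every arc i -> j is a boundary edge or is bypassed by two arcs
    i -> k -> j on the same side, then every non-chord (i,j) that is bypassed on
    both sides completes a triangulation, so it lies in each minimal blocker
    contained in the complement.

    On points 1..d joined according to 2-adic valuations, followed by
    O(log d) hubs, one for each scale, this yields saturated blockers missing only
    O(d log d) diagonals. Duplicating a vertex v of a saturated blocker gives a
    saturated blocker whose size has grown by the degree of v. The vertices 2^r
    are pairwise non-adjacent in the blocker and their degrees d - gap r, where
    gap r = 2^(r+1) - r - 2 roughly doubles with r, so O(log n) duplications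
    adjust the size to any prescribed value. Small sizes are reached by
    duplicating vertices of a heptagon blocked by five of its ears. *)

Set Implicit Arguments.
Unset Strict Implicit.
Unset Printing Implicit Defensive.

(* The MathComp imports rebind the key R to ring_scope. *)
Delimit Scope R_scope with R.

(** * Triangulations as derivations over an interval *)

(* tr R i j: the polygon i, i+1, ..., j has a triangulation with diagonals in R,
   its side (i,j) being given. *)
Inductive tr (R : rel nat) : nat -> nat -> Prop :=
| tr_edge i : tr R i i.+1
| tr_split i k j : R i k -> R k j -> tr R i k -> tr R k j -> tr R i j.

Lemma tr_lt R i j : tr R i j -> i < j.
Proof. by elim=> // {}i k {}j _ _ _ ik _; apply: ltn_trans. Qed.

Lemma tr_mono (R R' : rel nat) i j : subrel R R' -> tr R i j -> tr R' i j.
Proof.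
move=> sub; elim=> [{}i|{}i k {}j ik kj _ t1 _ t2]; first exact: tr_edge.
by apply: (tr_split (k := k)) => //; apply: sub.
Qed.

Definition allow (B : rel nat) : rel nat := fun a b => ~~ B a b.

Definition allow1 (B : rel nat) x y : rel nat :=
  fun a b => ~~ B a b || ((a == x) && (b == y)).

Definition diags N (B : rel nat) :=
  forall a b, B a b -> [/\ a.+1 < b, b <= N & ~~ ((a == 0) && (b == N))].

(** Saturation in terms of derivations: for each chord of [B] some triangulation meets [B] in at
    most that chord, hence in exactly that chord by the second clause. *)
Definition sat N (B : rel nat) :=
  [/\ diags N B, ~ tr (allow B) 0 N & forall x y, B x y -> tr (allow1 B x y) 0 N].

Definition eset n (B : rel nat) : {set edge n} := [set p : edge n | B p.1 p.2].

Definition ncross (a b c d : nat) :=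
  [|| [&& a < c, c < b & b < d] | [&& c < a, a < d & d < b]].

(** Over a side [(i,j)] the apex is the farthest neighbour [k] of [i] before [j]. A chord of [T]
    crossing [(k,j)] would cross [(i,j)] or [(i,k)], or be a longer chord from [i]. By maximality of
    [T], [(k,j)] is therefore a chord of [T] or a boundary edge, and the two smaller sides are
    treated recursively. *)
Lemma triangulation_tr N (B : rel nat) (T : {set edge N.+1}) :
  triangulation T -> (forall e, e \in T -> ~~ B e.1 e.2) ->
  diags N B -> 0 < N -> tr (allow B) 0 N.
Proof.
move=> [/subsetP Td [Tn Tm]] TB dB N0.
pose mT i j := [exists e in T, (val e.1 == i) && (val e.2 == j)].
have mTP i j : reflect (exists2 e, e \in T & val e.1 = i /\ val e.2 = j) (mT i j).
  apply: (iffP existsP) => [[e /andP[eT /andP[/eqP ? /eqP ?]]]|[e eT [<- <-]]].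
    by exists e.
  by exists e; rewrite eT !eqxx.
pose ok i j := [|| mT i j, (i == 0) && (j == N) | j == i.+1].
have okB i j : ok i j -> allow B i j.
  rewrite /allow; case/or3P => [/mTP[e eT [<- <-]]|ij|ij]; first exact: TB.
    by apply/negP => /dB[_ _]; rewrite ij.
  by apply/negP => /dB[+ _ _]; rewrite (eqP ij) ltnn.
have nc i j a b : mT i j -> mT a b -> ~~ ncross i j a b.
  by move=> /mTP[e eT [<- <-]] /mTP[f fT [<- <-]]; apply: (Tn e f).
have mTN i j : mT i j -> i.+1 < j <= N.
  move=> /mTP[e /Td + [<- <-]]; rewrite inE => /and3P[_ -> _].
  by rewrite /= -ltnS.
have mx i j : i.+1 < j -> j <= N -> ~~ ((i == 0) && (j == N)) -> ~~ mT i j ->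
    exists a b, mT a b /\ ncross i j a b.
  move=> ij jN nr nT.
  have iN : i < N.+1 by lia.
  have jN' : j < N.+1 by lia.
  have [||f fT cr] := Tm (Ordinal iN, Ordinal jN').
  - by rewrite inE /is_diag /= ij (ltnW ij) nr.
  - apply: contra nT => eT; apply/mTP; exists (Ordinal iN, Ordinal jN') => //.
  by exists (val f.1), (val f.2); split => //; apply/mTP; exists f.
suff H m i j : j - i < m -> i < j <= N -> ok i j -> tr (allow B) i j.
  by apply: (H N.+1) => //; rewrite ?subn0 ?N0 ?leqnn // /ok !eqxx orbT.
elim: m i j => // m IH i j jim /andP[ij jN] okij.
have [->|ji] := eqVneq j i.+1; first exact: tr_edge.
have ij2 : i.+1 < j by lia.
have ex : exists k, (i < k < j) && ok i k.
  by exists i.+1; rewrite leqnn ij2 /ok eqxx !orbT.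
have bd k : (i < k < j) && ok i k -> k <= j by lia.
have [k /andP[/andP[ik kj] okik] kmax] := ex_maxnP ex bd.
have okkj : ok k j.
  rewrite /ok; apply: contraT; rewrite !negb_or => /and3P[n1 n2 n3].
  have kj2 : k.+1 < j by lia.
  have nr : ~~ ((k == 0) && (j == N)) by lia.
  have [a [b [Tab cr]]] := mx _ _ kj2 jN nr n1.
  have := mTN _ _ Tab => abN.
  have c1 : mT i j -> ~~ ncross i j a b by move=> h; apply: nc.
  have c2 : mT i k -> ~~ ncross i k a b by move=> h; apply: nc.
  have km : a = i -> b < j -> b <= k.
    move=> ai bj; apply: kmax; rewrite bj -ai /ok Tab; lia.
  move: okij okik cr c1 c2 km; rewrite /ok /ncross.
  case: (mT i j) => /=; case: (mT i k) => /=; lia.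
apply: (tr_split (k := k)); try exact: okB.
  by apply: IH => //; lia.
by apply: IH => //; lia.
Qed.

Lemma tr_chords (R : rel nat) i j : tr R i j ->
  exists T : rel nat,
  [/\ forall a b, T a b -> [/\ i <= a, a.+1 < b, b <= j, ~~ ((a == i) && (b == j)) & R a b],
      forall a b c d, T a b -> T c d -> ~~ ncross a b c d
    & forall a b, i <= a -> a.+1 < b -> b <= j -> ~~ ((a == i) && (b == j)) ->
        ~~ T a b -> exists c d, T c d /\ ncross a b c d].
Proof.
elim=> {i j} [i|i k j Rik Rkj /tr_lt ik [T1 [in1 nc1 mx1]] /tr_lt kj [T2 [in2 nc2 mx2]]].
  by exists (fun _ _ => false); split => // a b; lia.
exists (fun a b => [|| T1 a b, T2 a b, [&& a == i, b == k & i.+1 < k]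
                     | [&& a == k, b == j & k.+1 < j]]).
have in' a b : [|| T1 a b, T2 a b, [&& a == i, b == k & i.+1 < k]
                     | [&& a == k, b == j & k.+1 < j]] ->
   [/\ a.+1 < b, R a b & (i <= a /\ b <= k) \/ (k <= a /\ b <= j)].
  case/or4P => [/in1[? ? ? _ ?]|/in2[? ? ? _ ?]|/and3P[/eqP-> /eqP-> ?]|/and3P[/eqP-> /eqP-> ?]];
  split => //; lia.
split.
- by move=> a b /in'[? ? ?]; split => //; lia.
- move=> a b c d Tab Tcd.
  have b1 x y : T1 x y ==> (i <= x) && (x < y <= k) by apply/implyP => /in1[]; lia.
  have b2 x y : T2 x y ==> (k <= x) && (x < y <= j) by apply/implyP => /in2[]; lia.
  have : (T1 a b && T1 c d) ==> ~~ ncross a b c d.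
    by apply/implyP => /andP[]; apply: nc1.
  have : (T2 a b && T2 c d) ==> ~~ ncross a b c d.
    by apply/implyP => /andP[]; apply: nc2.
  move: (b1 a b) (b1 c d) (b2 a b) (b2 c d) Tab Tcd; rewrite /ncross.
  case: (T1 a b) => /=; case: (T2 a b) => /=; case: (T1 c d) => /=; case: (T2 c d) => /=; lia.
- move=> a b ia ab bj nij; rewrite !negb_or => /and4P[n1 n2 n3 n4].
  have [bk|kb] := leqP b k.
    have nk : ~~ ((a == i) && (b == k)) by lia.
    have [c [d [h1 h2]]] := mx1 a b ia ab bk nk n1.
    by exists c, d; rewrite h1.
  have [ka|ak] := leqP k a.
    have nk : ~~ ((a == k) && (b == j)) by lia.
    have [c [d [h1 h2]]] := mx2 a b ka ab bj nk n2.
    by exists c, d; rewrite h1 orbT.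
  (* The remaining chords straddle the apex [k]: they cross [(i,k)] if they start after [i], and
     otherwise end before [j] and cross [(k,j)]. *)
  have [ai|ai] := ltnP i a.
    exists i, k; split; first by rewrite !eqxx /=; apply/or4P; constructor 3; lia.
    by rewrite /ncross; lia.
  exists k, j; split; first by rewrite !eqxx /=; apply/or4P; constructor 4; lia.
  by rewrite /ncross; lia.
Qed.

Lemma tr_triangulation N (R : rel nat) : tr R 0 N ->
  exists2 T : {set edge N.+1}, triangulation T & forall e, e \in T -> R e.1 e.2.
Proof.
move=> /tr_chords [T [inT ncT mxT]].
exists (eset N.+1 T); last by move=> e; rewrite inE => /inT[].
split; last split.
- apply/subsetP => e; rewrite !inE => /inT[_ h1 _ h2 _].
  by rewrite /is_diag h1 (ltnW h1) h2.
- by move=> e f; rewrite !inE => Te Tf; apply: ncT.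
move=> e; rewrite !inE => /and3P[h0 h1 h2] nT.
have [c [d [Tcd cr]]] := mxT e.1 e.2 (leq0n _) h1 (ltn_ord e.2) h2 nT.
have [_ cd dN _ _] := inT _ _ Tcd.
have cN : c < N.+1 by lia.
by exists (Ordinal cN, Ordinal (dN : d < N.+1)); rewrite ?inE.
Qed.

Lemma blocker_tr N (B : rel nat) : 0 < N -> diags N B ->
  (blocker (eset N.+1 B) <-> ~ tr (allow B) 0 N).
Proof.
move=> N0 dB; split.
  move=> [_ bl] /tr_triangulation[T triT TB].
  have [e] := bl T triT; rewrite inE => eB /TB.
  by rewrite /allow eB.
move=> ntr; split.
  apply/subsetP => e; rewrite !inE => /dB[h1 _ h2].
  by rewrite /is_diag h1 (ltnW h1) h2.
move=> T triT; apply: NNPP => nex; apply: ntr; apply: (triangulation_tr triT) => //.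
by move=> e eT; apply/negP => eB; apply: nex; exists e; rewrite ?inE.
Qed.

Lemma sat_saturated N (B : rel nat) : 0 < N -> sat N B ->
  saturated_blocker (eset N.+1 B).
Proof.
move=> N0 [dB ntr str]; split; first exact/blocker_tr.
move=> [e1 e2]; rewrite inE /= => eB.
pose B' := fun a b => B a b && ~~ ((a == e1) && (b == e2)).
have -> : eset N.+1 B :\ (e1, e2) = eset N.+1 B'.
  by apply/setP => -[f1 f2]; rewrite !inE xpair_eqE andbC.
move=> /blocker_tr[] //; first by move=> a b /andP[/dB].
apply: tr_mono (str _ _ eB) => a b.
by rewrite /allow1 /allow /B' negb_and negbK.
Qed.

Definition cnt N (B : rel nat) := \sum_(x < N.+1) \sum_(y < N.+1) B x y.

Lemma card_eset N (B : rel nat) : #|eset N.+1 B| = cnt N B.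
Proof.
rewrite -sum1_card /cnt pair_big /= big_mkcond /=.
by apply: eq_bigr => e _; rewrite inE; case: (B _ _).
Qed.

Lemma sat_sub N (B : rel nat) : diags N B -> ~ tr (allow B) 0 N ->
  exists B' : rel nat, [/\ sat N B', subrel B' B
    & forall x y, B x y -> tr (allow1 B x y) 0 N -> B' x y].
Proof.
move=> dB ntr.
suff [B' [sB' sub]] : exists B' : rel nat, sat N B' /\ subrel B' B.
  exists B'; split => // x y Bxy t1; apply: contraT => nB'.
  have [_ + _] := sB'; case; apply: tr_mono t1 => a b.
  rewrite /allow1 /allow; case/orP => [|/andP[/eqP-> /eqP->]] //.
  by apply: contra => /sub.
have [m] := ubnP (cnt N B); elim: m B dB ntr => // m IH B dB ntr cB.
have [str|/not_all_ex_not[x /not_all_ex_not[y]]] :=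
  classic (forall x y, B x y -> tr (allow1 B x y) 0 N).
  by exists B; split.
move=> h; have {h} [Bxy nt] := imply_to_and _ _ h.
pose B' := fun a b => B a b && ~~ ((a == x) && (b == y)).
have subB : subrel B' B by move=> a b /andP[].
have leB a b : (B' a b <= B a b)%N by rewrite /B'; case: (B a b); case: (~~ _).
have [||| B'' [s1 s2]] := IH B'.
- by move=> a b /subB /dB.
- move=> h; apply: nt; apply: tr_mono h => a b.
  by rewrite /allow1 /allow /B' negb_and negbK.
- rewrite -ltnS; apply: leq_ltn_trans cB.
  have [xy yN _] := dB _ _ Bxy.
  have xN : x < N.+1 by lia.
  rewrite /cnt (bigD1 (Ordinal xN)) //= [X in _ < X](bigD1 (Ordinal xN)) //=.
  rewrite -addSn leq_add //; last first.
    by apply: leq_sum => i _; apply: leq_sum => j _; apply: leB.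
  rewrite (bigD1 (Ordinal (yN : y < N.+1))) //= [X in _ < X](bigD1 (Ordinal (yN : y < N.+1))) //=.
  rewrite {1}/B' Bxy !eqxx /= add0n add1n ltnS.
  by apply: leq_sum => j _; apply: leB.
by exists B''; split => // a b /s2 /subB.
Qed.

(** * Duplicating a vertex *)

Definition deg N (B : rel nat) v := \sum_(y < N.+1) (B v y + B y v).
Definition adj (B : rel nat) v w : nat := B v w + B w v.

(** [merge c] collapses the twins [c] and [c.+1], while [skip h] is the increasing enumeration of
    the vertices other than [h]; for either twin [h] it is a section of [merge c]. *)
Definition merge c x := x - (c < x).
Definition skip h x := x + (h <= x).
Definition dup (B : rel nat) c : rel nat := fun x y => B (merge c x) (merge c y).

Lemma sum_merge N c (G : nat -> nat) : c <= N ->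
  \sum_(x < N.+2) G (merge c x) = \sum_(x < N.+1) G x + G c.
Proof.
move=> cN; rewrite -!(big_mkord xpredT (fun x => G (merge c x))) -(big_mkord xpredT G).
rewrite (big_cat_nat (n := c.+1)) //=; last by lia.
rewrite [X in _ = X + _](big_cat_nat (n := c.+1)) //=.
rewrite -addnA; congr (_ + _).
  by apply: eq_big_nat => i ?; congr G; rewrite /merge; lia.
rewrite big_nat_recl //= addnC; congr (_ + _).
  by apply: eq_big_nat => i ?; congr G; rewrite /merge; lia.
by congr G; rewrite /merge; lia.
Qed.

Lemma dup_diags N (B : rel nat) c : c <= N -> diags N B -> diags N.+1 (dup B c).
Proof. by move=> cN dB x y /dB; rewrite /merge => -[]; split; lia. Qed.

Lemma tr_dup_merge N (B : rel nat) c x y : c <= N -> diags N B ->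
  tr (allow (dup B c)) x y ->
  merge c x = merge c y \/ tr (allow B) (merge c x) (merge c y).
Proof.
move=> cN dB; elim=> {x y} [i|i k j Rik Rkj _ IH1 _ IH2].
  have : merge c i = merge c i.+1 \/ merge c i.+1 = (merge c i).+1.
    by rewrite /merge; lia.
  by case=> [|->]; [left|right; apply: tr_edge].
case: IH1 => [e1|t1]; case: IH2 => [e2|t2].
- by left; rewrite e1.
- by right; rewrite e1.
- by right; rewrite -e2.
- by right; apply: tr_split t1 t2.
Qed.

Lemma tr_skip N (B S' : rel nat) h c x y : c <= N -> diags N B ->
  (h == c) || (h == c.+1) -> subrel (allow (dup B c)) S' ->
  forall S : rel nat, (forall a b, S a b -> S' (skip h a) (skip h b)) ->
  tr S x y -> tr S' (skip h x) (skip h y).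
Proof.
move=> cN dB hc sub S SS'; elim=> {x y} [i|i k j /SS' Rik /SS' Rkj _ IH1 _ IH2].
  have e p : S' p p.+1.
    by apply: sub; rewrite /allow; apply/negP => /(dup_diags cN dB)[]; rewrite ltnn.
  (* The boundary edge that passes over [h] becomes a side on which [h] sits as an ear. *)
  have : skip h i.+1 = (skip h i).+1 \/ skip h i.+1 = (skip h i).+2.
    by rewrite /skip; lia.
  case=> ->; first exact: tr_edge.
  by apply: (tr_split (k := (skip h i).+1)) => //; apply: tr_edge.
exact: tr_split IH1 IH2.
Qed.

(** Collapsing the twins turns a triangulation avoiding [dup B c] into one avoiding [B]. For
    saturation, the triangulation given for the collapsed chord is spread over all vertices but one
    twin [h], distinct from [x] and [y], and [h] is restored as an ear. *)
Lemma sat_dup N (B : rel nat) c : 0 < N -> c <= N -> sat N B -> sat N.+1 (dup B c).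
Proof.
move=> N0 cN [dB ntr str]; split; first exact: dup_diags.
  move=> /(tr_dup_merge cN dB).
  have -> : merge c 0 = 0 by rewrite /merge; lia.
  have -> : merge c N.+1 = N by rewrite /merge; lia.
  by case=> // N0'; move: N0; rewrite -N0'.
move=> x y Bxy; have [xy yN _] := dB _ _ Bxy.
have [h hc [hx hy]] : exists2 h, (h == c) || (h == c.+1) &
    skip h (merge c x) = x /\ skip h (merge c y) = y.
  have [/orP xc|xc] := boolP ((x == c.+1) || (y == c.+1)).
    by exists c; rewrite ?eqxx //; move: xy; rewrite /skip /merge; lia.
  by exists c.+1; rewrite ?eqxx ?orbT // /skip /merge; lia.
have sub : subrel (allow (dup B c)) (allow1 (dup B c) x y) by move=> a b; rewrite /allow /allow1 => ->.
have mK z : merge c (skip h z) = z by rewrite /merge /skip; lia.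
have sk : forall a b, allow1 B (merge c x) (merge c y) a b ->
    allow1 (dup B c) x y (skip h a) (skip h b).
  move=> a b; rewrite /allow1 /dup !mK; case/orP => [->//|/andP[/eqP-> /eqP->]].
  by rewrite hx hy !eqxx orbT.
have t := tr_skip cN dB hc sub sk (str _ _ Bxy).
have free a b : merge c a = 0 -> merge c b = N -> allow1 (dup B c) x y a b.
  move=> a0 bN; apply: sub; rewrite /allow /dup a0 bN.
  by apply/negP => /dB[_ _]; rewrite !eqxx.
have ed p : allow1 (dup B c) x y p p.+1.
  by apply: sub; rewrite /allow; apply/negP => /(dup_diags cN dB)[]; rewrite ltnn.
(* If the omitted twin is the first or the last vertex, its ear lies on the root side and is cut off
   by a copy of the root edge, which [dup B c] does not contain. *)
have [h0|h0] := posnP h.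
  move: t; have -> : skip h 0 = 1 by rewrite /skip; lia.
  have -> : skip h N = N.+1 by rewrite /skip; lia.
  move=> t; apply: (tr_split (k := 1)) (tr_edge _ _) t => //.
  by apply: free; rewrite /merge; lia.
have e0 : skip h 0 = 0 by rewrite /skip; lia.
rewrite e0 in t; have [hN|hN] := leqP h N.
  by have -> : N.+1 = skip h N by rewrite /skip; lia.
have eN : skip h N = N by rewrite /skip; lia.
rewrite eN in t; apply: (tr_split (k := N)) t (tr_edge _ _) => //.
by apply: free; rewrite /merge; lia.
Qed.

Lemma cnt_dup N (B : rel nat) c : c <= N -> diags N B ->
  cnt N.+1 (dup B c) = cnt N B + deg N B c.
Proof.
move=> cN dB.
rewrite /cnt (sum_merge (fun x => \sum_(y < N.+2) (B x (merge c y) : nat)) cN).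
under eq_bigr => x _ do rewrite (sum_merge (fun y => B x y : nat) cN).
rewrite (sum_merge (fun y => B c y : nat) cN) big_split /= -addnA; congr (_ + _).
have -> : B c c = false by apply/negP => /dB[]; lia.
by rewrite addn0 /deg big_split addnC.
Qed.

Lemma deg_dup N (B : rel nat) c x : c <= N ->
  deg N.+1 (dup B c) (skip c.+1 x) = deg N B x + adj B x c.
Proof.
move=> cN; have mK : merge c (skip c.+1 x) = x by rewrite /merge /skip; lia.
rewrite /deg /dup mK.
by rewrite (sum_merge (fun y => (B x y : nat) + B y x) cN).
Qed.

Lemma adj_dup (B : rel nat) c x y :
  adj (dup B c) (skip c.+1 x) (skip c.+1 y) = adj B x y.
Proof.
by have mK z : merge c (skip c.+1 z) = z; rewrite /merge /skip /adj /dup ?mK; lia.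
Qed.

(* The adjacencies M between marked vertices tell how duplicating one of them
   changes the degrees of the others. *)
Definition conf (I : Type) N t (M : I -> I -> nat) (d : I -> nat) :=
  exists (B : rel nat) (q : I -> nat), [/\ sat N B, cnt N B = t,
    forall i, q i <= N /\ deg N B (q i) = d i & forall i j, adj B (q i) (q j) = M i j].

Lemma conf_dup (I : Type) N t M (d : I -> nat) i : 0 < N -> conf N t M d ->
  conf N.+1 (t + d i) M (fun j => d j + M j i).
Proof.
move=> N0 [B [q [sB <- qd qM]]]; have [qiN <-] := qd i.
have [dB _ _] := sB.
exists (dup B (q i)), (fun j => skip (q i).+1 (q j)); split.
- exact: sat_dup.
- exact: cnt_dup.
- move=> j; have [qjN <-] := qd j; split; first by rewrite /skip; lia.
  by rewrite deg_dup // qM.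
- by move=> j k; rewrite adj_dup qM.
Qed.

Lemma conf_ext (I : Type) N t M (d d' : I -> nat) :
  d =1 d' -> conf N t M d -> conf N t M d'.
Proof. by move=> dd [B [q [sB <- qd qM]]]; exists B, q; split => // i; rewrite -dd. Qed.

Lemma conf_dups (I : Type) N t M (d : I -> nat) i m : 0 < N -> M i i = 0 ->
  conf N t M d -> conf (N + m) (t + m * d i) M (fun j => d j + m * M j i).
Proof.
move=> N0 Mi cf; elim: m => [|m IH].
  by rewrite mul0n !addn0; apply: conf_ext cf => j; rewrite mul0n addn0.
have := conf_dup i (ltn_addr m N0) IH.
rewrite addnS Mi muln0 addn0 mulSn -addnA [m * _ + _]addnC.
by apply: conf_ext => j; rewrite mulSn addnA addnAC.
Qed.

Lemma conf_indep (I : Type) N t (d : I -> nat) (w : seq I) : 0 < N ->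
  conf N t (fun _ _ => 0) d ->
  conf (N + size w) (t + \sum_(i <- w) d i) (fun _ _ => 0) d.
Proof.
move=> N0 cf; elim: w => [|i w IH]; first by rewrite big_nil !addn0.
have := conf_dup i (ltn_addr _ N0) IH.
rewrite big_cons /= addnS (addnC (d i)) addnA.
by apply: conf_ext => j; rewrite addn0.
Qed.

Lemma conf_nk (I : Type) N t M (d : I -> nat) : 0 < N -> conf N t M d ->
  exists B : {set edge N.+1}, nk_blocker t B.
Proof.
move=> N0 [B [q [sB <- _ _]]]; exists (eset N.+1 B).
by split; [exact: sat_saturated|exact: card_eset].
Qed.

(** * Sparse blockers *)

(** A decision procedure for [tr] with fuel [m], so that the heptagon can be settled by
    computation. *)
Fixpoint trb (R : rel nat) m i j :=
  if m is m'.+1 then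
    (j == i.+1) || has (fun k => [&& R i k, R k j, trb R m' i k & trb R m' k j])
                       (iota i.+1 (j - i.+1))
  else false.

Lemma trbP (R : rel nat) m i j : i < j -> j - i <= m -> reflect (tr R i j) (trb R m i j).
Proof.
move=> ij jim; apply: (iffP idP) => [{ij jim}|t].
  elim: m i j => //= m IH i j /orP[/eqP->|/hasP[k _ /and4P[ik kj /IH t1 /IH t2]]].
    exact: tr_edge.
  exact: tr_split t1 t2.
elim: t m {ij} jim => {i j} [i|i k j ik kj t1 IH1 t2 IH2] [|m] /=; rewrite ?eqxx //.
- lia.
- by have := tr_lt t1; have := tr_lt t2; lia.
move=> jim; have := tr_lt t1; have := tr_lt t2 => lt1 lt2.
apply/orP; right; apply/hasP; exists k; first by rewrite mem_iota; lia.
by rewrite ik kj IH1 ?IH2 //; lia.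
Qed.

(** The chords cutting off the ears at 2, 3, 4, 5 and 6. Every triangulation has two non-adjacent
    ears, so they cannot both be among the adjacent vertices 0 and 1. *)
Definition heptagon : rel nat := fun x y =>
  (x, y) \in [:: (1, 3); (2, 4); (3, 5); (4, 6); (0, 5)].

Lemma heptagon_sat : sat 6 heptagon.
Proof.
split.
- by move=> a b; rewrite /heptagon !inE !xpair_eqE => h; split; lia.
- by apply/(elimN (@trbP _ 6 0 6 isT isT)).
move=> x y; rewrite /heptagon !inE !xpair_eqE => h.
apply/(@trbP _ 6 0 6 isT isT); move: h.
by case/or4P => [|||/orP[|]] /andP[/eqP-> /eqP->]; vm_compute.
Qed.

Lemma heptagon_conf : conf 6 5 (fun i j : 'I_4 => (i + j == 1 : nat))
  (fun i => nth 0 [:: 2; 1; 2; 1] i).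
Proof.
exists heptagon, (fun i => nth 0 [:: 3; 1; 4; 0] i); split.
- exact: heptagon_sat.
- by rewrite /cnt !big_ord_recr !big_ord0.
- by case=> [[|[|[|[|]]]]] //= ?; rewrite /deg !big_ord_recr big_ord0.
- by case=> [[|[|[|[|]]]]] //= ? [[|[|[|[|]]]]].
Qed.

(** Vertices 3 and 1 are joined in the blocker, so [a] extra copies of 3 raise the degree of 1 to
    [1 + a], and each of the [u] copies of 1 then adds that much. Copies of 4 and 0 add 2 and 1
    without interfering. *)
Lemma heptagon_blowup a u v w :
  exists B : {set edge (6 + a + u + v + w).+1},
    nk_blocker (5 + a * 2 + u * (1 + a) + v * 2 + w) B.
Proof.
have := conf_dups (i := inord 0) a _ _ heptagon_conf; rewrite inordK // => /(_ isT erefl).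
move/(conf_dups (i := inord 1) u) => /=; rewrite !inordK // muln1 => /(_ isT erefl).
move/(conf_dups (i := inord 2) v) => /=; rewrite !inordK // !muln0 !addn0 => /(_ isT erefl).
move/(conf_dups (i := inord 3) w) => /=; rewrite !inordK // !muln0 !addn0 => /(_ isT erefl).
by rewrite muln1 => /conf_nk; apply.
Qed.

Lemma sparse_range n t : 100 < n -> n - 2 <= t -> 16 * t <= n ^ 2 ->
  exists B : {set edge n}, nk_blocker t B.
Proof.
move=> n100 lo hi.
suff [a [u [v [w [-> ->]]]]] : exists a u v w,
  n = (6 + a + u + v + w).+1 /\ t = 5 + a * 2 + u * (1 + a) + v * 2 + w.
  exact: heptagon_blowup.
have [sm|lg] := ltnP (t - (n - 2)) (n %/ 4).
  by exists 0, 0, (t - (n - 2)), (n - 7 - (t - (n - 2))); lia.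
pose a := n %/ 4; pose m := (t - (n - 2)) %/ a; pose v := (t - (n - 2)) %% a.
have a0 : 0 < a by rewrite /a; lia.
have va : v < a by apply: ltn_pmod.
have e : t - (n - 2) = m * a + v by apply: divn_eq.
have m0 : 0 < m by rewrite divn_gt0.
have m2 : 3 * m <= n.
  have : 16 * (m * a) <= n ^ 2 by lia.
  have : n < 4 * a + 4 by rewrite /a; lia.
  rewrite expnS expn1; nia.
have a4 : 4 * a <= n by rewrite /a; lia.
exists a, m.-1, v, (n - 7 - a - m.-1 - v).
case: (m) m0 e m2 => // k _ e m2 /=; rewrite mulSn in e.
rewrite mulnDr muln1; move: e; set ka := k * a; lia.
Qed.

(** * Points joined by 2-adic valuations *)

(** Scale [s] separates [x] from [y] if neither is a multiple of [2 ^ s] and such a multiple lies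
    strictly between them; [loc] joins the pairs separated at no scale. Separation forces
    [2 ^ s <= y], which makes the bounded test in [loc] exhaustive. *)
Definition split_at s x y :=
  [&& ~~ (2 ^ s %| x), ~~ (2 ^ s %| y) & x %/ 2 ^ s < y %/ 2 ^ s].
Definition loc x y := (x < y) && all (fun s => ~~ split_at s x y) (iota 0 y).
(** The interiors of the even and of the odd blocks of length [2 ^ s]; they are the seeds of the two
    sides of cut [s]. *)
Definition left s x := ~~ (2 ^ s %| x) && ~~ odd (x %/ 2 ^ s).
Definition right s x := ~~ (2 ^ s %| x) && odd (x %/ 2 ^ s).

Lemma split_at_exp_leq s x y : split_at s x y -> 2 ^ s <= y.
Proof.
case/and3P => _ _ h; have : 0 < y %/ 2 ^ s by apply: leq_ltn_trans h.
by rewrite divn_gt0 // expn_gt0.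
Qed.

Lemma locP x y : reflect (x < y /\ forall s, ~~ split_at s x y) (loc x y).
Proof.
apply: (iffP andP) => -[xy h]; split => //; last by apply/allP => s _.
move=> s; apply/negP => sp; have := split_at_exp_leq sp; have := ltn_expl s (ltnSn 1).
move=> h1 h2; have : s \in iota 0 y by rewrite mem_iota; lia.
by move=> /(allP h); rewrite sp.
Qed.

Lemma loc_lt x y : loc x y -> x < y. Proof. by case/andP. Qed.

Lemma left_right_loc s x y : loc x y -> left s x -> right s y -> False.
Proof.
case/locP => xy /(_ s) /negP ns /andP[lx ox] /andP[ry oy]; apply: ns.
rewrite /split_at lx ry /= ltn_neqAle leq_div2r ?(ltnW xy) // andbT.
by apply: contra ox => /eqP->.
Qed.

(* At the largest scale separating x from y, they lie in consecutive blocks. *)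
Lemma nloc_cut x y : x < y -> ~~ loc x y ->
  exists s, [/\ left s x, right s y & 2 ^ s <= y].
Proof.
move=> xy; rewrite /loc xy /= => /allPn[s0 _]; rewrite negbK => sp0.
have bd s : split_at s x y -> s <= y.
  by move=> /split_at_exp_leq; have := ltn_expl s (ltnSn 1); lia.
have [s sp smax] := ex_maxnP (ex_intro _ s0 sp0) bd.
exists s; have [lx ly lt] := and3P sp.
have dv z : ~~ (2 ^ s %| z) -> ~~ (2 ^ s.+1 %| z).
  by apply: contra; apply: dvdn_trans; rewrite dvdn_exp2l.
have : ~~ split_at s.+1 x y by apply/negP => /smax; lia.
rewrite /split_at !dv //= expnSr !divnMA => h.
rewrite /left /right lx ly (split_at_exp_leq sp); split; lia.
Qed.

Lemma loc_succ x : loc x x.+1.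
Proof.
apply/locP; split => // s; apply/negP => /and3P[nx ny].
by rewrite divnS ?expn_gt0 // (negPf ny) add0n ltnn.
Qed.

(* The middle point is divisible by the largest power of 2 available. *)
Lemma loc_hop x y : x.+1 < y -> exists k, [/\ x < k < y, loc x k & loc k y].
Proof.
move=> xy; pose P r := has (fun k => 2 ^ r %| k) (iota x.+1 (y - x.+1)).
have inP r k : x < k < y -> 2 ^ r %| k -> P r.
  by move=> ? ?; apply/hasP; exists k => //; rewrite mem_iota; lia.
have P0 : P 0 by apply: (inP 0 x.+1) => //; lia.
have bd r : P r -> r <= y.
  case/hasP => k; rewrite mem_iota => kxy /dvdn_leq h.
  by have := ltn_expl r (ltnSn 1); lia.
have [r /hasP[k]] := ex_maxnP (ex_intro _ 0 P0) bd.
rewrite mem_iota => kxy rk rmax; have {}kxy : x < k < y by lia.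
have big s z : ~~ (2 ^ s %| k) -> x < z < y -> 2 ^ s %| z -> False.
  move=> sk zxy /(inP _ _ zxy) /rmax sr.
  by move/negP: sk; apply; apply: dvdn_trans rk; rewrite dvdn_exp2l.
(* A separating scale has a grid point strictly between the two points. If one of them is [k], this
   contradicts, through [big], the choice of [k]. *)
have fl s a b : split_at s a b -> exists2 z, a < z < b & 2 ^ s %| z.
  case/and3P => _ nb lt; exists (b %/ 2 ^ s * 2 ^ s); last exact: dvdn_mull.
  have e := divn_eq b (2 ^ s).
  have s0 : 0 < 2 ^ s by rewrite expn_gt0.
  have : 0 < b %% 2 ^ s by rewrite lt0n.
  move=> m0; apply/andP; split; first by rewrite -ltn_divLR.
  by rewrite [X in _ < X]e -[X in X < _]addn0 ltn_add2l.
exists k; split => //; apply/locP; (split; first by lia) => s.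
  apply/negP => sp; have [z h dz] := fl _ _ _ sp.
  by apply: (big s z) => //; [case/and3P: sp|lia].
apply/negP => sp; have [z h dz] := fl _ _ _ sp.
by apply: (big s z) => //; [case/and3P: sp|lia].
Qed.

Lemma ndvd_exp2 s r : ~~ (2 ^ s %| 2 ^ r) -> r < s.
Proof. by apply: contraR; rewrite -leqNgt => h; rewrite dvdn_exp2l. Qed.

Lemma loc_exp2l r y : 2 ^ r < y < 2 ^ r.+1 -> loc (2 ^ r) y.
Proof.
move=> /andP[ry yr]; apply/locP; split => // s; apply/negP => /and3P[/ndvd_exp2 rs _].
rewrite [X in _ < X]divn_small //; apply: leq_trans yr _.
by rewrite leq_exp2l.
Qed.

Lemma loc_exp2r r x : x < 2 ^ r -> loc x (2 ^ r).
Proof.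
move=> xr; apply/locP; split => // s; apply/negP => /and3P[_ /ndvd_exp2 rs].
by rewrite [X in _ < X]divn_small // ltn_exp2l.
Qed.

(** The scale of the leading bit of [y] separates the two points. *)
Lemma nloc_exp2 r y : 2 ^ r.+1 <= y -> y != 2 ^ trunc_log 2 y -> ~~ loc (2 ^ r) y.
Proof.
move=> ry npow; apply/negP => /locP[_ /(_ (trunc_log 2 y))] /negP; apply.
have y0 : 0 < y by apply: leq_trans ry; rewrite expn_gt0.
have /andP[l1 l2] := trunc_log_bounds (ltnSn 1) y0.
have rs : r < trunc_log 2 y by apply: trunc_log_max.
set s := trunc_log 2 y in npow l1 l2 rs *.
have ys : y %/ 2 ^ s = 1.
  apply/eqP; rewrite eqn_leq -ltnS ltn_divLR ?expn_gt0 // -expnS l2.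
  by rewrite divn_gt0 ?expn_gt0.
rewrite /split_at ys divn_small ?ltn_exp2l // andbT; apply/andP; split.
  by apply/negP => /dvdn_leq; rewrite expn_gt0 leq_exp2l // => /(_ isT); lia.
by apply: contra npow => /divnK; rewrite ys mul1n => <-.
Qed.

Definition nadj v y := [&& y != v, ~~ loc v y & ~~ loc y v].

Lemma nadj_exp2 r y : nadj (2 ^ r) y = (2 ^ r.+1 <= y) && (y != 2 ^ trunc_log 2 y).
Proof.
have lt r' : 2 ^ r' < 2 ^ r'.+1 by rewrite ltn_exp2l.
rewrite /nadj; have [h|h] /= := leqP (2 ^ r.+1) y; last first.
  case: (ltngtP y (2 ^ r)) => c //=; first by rewrite (loc_exp2r c) andbF.
  by rewrite loc_exp2l // c h.
have c : 2 ^ r < y := leq_trans (lt r) h.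
have -> : loc y (2 ^ r) = false by apply/negP => /loc_lt; lia.
rewrite neq_ltn c orbT andbT /=.
have [e|/(nloc_exp2 h) -> //] := eqVneq y (2 ^ trunc_log 2 y).
by rewrite e loc_exp2r // -e.
Qed.

Lemma sum_ge_ord d a : a <= d.+1 -> \sum_(y < d.+1) (a <= y : nat) = d.+1 - a.
Proof.
move=> ad; rewrite -(big_mkord xpredT (fun y => a <= y : nat)).
rewrite (big_cat_nat (n := a)) //= big_nat_cond big1 ?add0n; last first.
  by move=> i /andP[/andP[_ ia] _]; rewrite leqNgt ia.
rewrite (eq_big_nat _ _ (F2 := fun=> 1)); first by rewrite sum_nat_const_nat muln1.
by move=> i /andP[-> _].
Qed.

Lemma sum_eq_ord d a : a <= d -> \sum_(y < d.+1) (y == a :> nat : nat) = 1.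
Proof.
rewrite -ltnS => ad; rewrite (bigD1 (Ordinal ad)) //= eqxx big1 // => y.
by rewrite -val_eqE /= => /negPf ->.
Qed.

(** By [nadj_exp2] these are the [d + 1 - 2 ^ r.+1] numbers from [2 ^ r.+1] to [d], less the
    [S - r.+1] powers of 2 among them. The additive form avoids truncated subtraction. *)
Lemma sum_nadj_exp2 r d S : 2 ^ S.-1 <= d < 2 ^ S -> r < S.-1 ->
  \sum_(y < d.+1) (nadj (2 ^ r) y : nat) + 2 ^ r.+1 + S = d + 2 + r.
Proof.
move=> /andP[dl dr] rS.
have pt (y : 'I_d.+1) :
    nadj (2 ^ r) y + \sum_(r.+1 <= s < S) (y == 2 ^ s :> nat : nat) = (2 ^ r.+1 <= y).
  rewrite nadj_exp2; have [h|h] /= := leqP (2 ^ r.+1) y; last first.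
    rewrite add0n big_nat_cond big1 // => s /andP[/andP[rs _] _].
    suff : y < 2 ^ s by case: eqP => // ->; rewrite ltnn.
    by apply: leq_trans h _; rewrite leq_exp2l.
  have y0 : 0 < y by apply: leq_trans h; rewrite expn_gt0.
  have rs : r < trunc_log 2 y by apply: trunc_log_max.
  have sS : trunc_log 2 y < S.
    have := trunc_logP (ltnSn 1) y0; have := ltn_ord y => yd h1.
    have : 2 ^ trunc_log 2 y < 2 ^ S by lia.
    by rewrite ltn_exp2l.
  have [e|ne] /= := eqVneq (y : nat) (2 ^ trunc_log 2 y); last first.
    rewrite big_nat_cond big1 // => s _; case: eqP => // e.
    by move: ne; rewrite e trunc_expnK // eqxx.
  rewrite add0n (bigD1_seq (trunc_log 2 y)) ?iota_uniq //=; last first.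
    by rewrite mem_index_iota rs sS.
  rewrite -e eqxx big1 // => s ns; case: eqP => // es.
  by move: ns; rewrite es trunc_expnK // eqxx.
have le : 2 ^ r.+1 <= 2 ^ S.-1 by rewrite leq_exp2l.
have h1 : \sum_(y < d.+1) (nadj (2 ^ r) y : nat) + (S - r.+1) = d.+1 - 2 ^ r.+1.
  rewrite -(@sum_ge_ord d (2 ^ r.+1)); last by lia.
  rewrite -(eq_bigr _ (fun y _ => pt y)) big_split /=; congr (_ + _).
  rewrite exchange_big /= big_nat_cond (eq_bigr (fun=> 1)).
    by rewrite -big_nat_cond sum_nat_const_nat muln1.
  move=> s /andP[/andP[_ sS] _]; apply: sum_eq_ord; apply: leq_trans dl.
  by rewrite leq_exp2l //; lia.
move: (2 ^ r.+1) (2 ^ S.-1) le dl h1 => A B; lia.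
Qed.

(** The midpoint of the block of length [2 ^ r.+1] containing [x], which is the only point of 2-adic
    valuation [r] in that block. *)
Definition lift_to r x := x %/ 2 ^ r.+1 * 2 ^ r.+1 + 2 ^ r.

(* A point is joined to at most one more divisible point of each valuation,
   hence the bound O(d log d) on the number of joined pairs. *)
Lemma loc_lift x y S : 0 < x -> y < 2 ^ S -> loc x y ->
  exists r : 'I_S, (y == lift_to r x) || (x == lift_to r y).
Proof.
move=> x0 yS /locP[xy h].
have dec z : 0 < z -> exists2 q, z = q * 2 ^ (logn 2 z).+1 + 2 ^ logn 2 z
    & forall s, logn 2 z < s -> ~~ (2 ^ s %| z).
  move=> z0; have [m cm e] := pfactor_coprime (isT : prime 2) z0.
  exists m./2.
    rewrite {1}e; move: cm; rewrite coprime2n => om.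
    by rewrite -{1}(odd_double_half m) om mulnDl mul1n addnC -muln2 -mulnA -expnS.
  by move=> s; rewrite pfactor_dvdn // -ltnNge.
have lt z : 0 < z -> z < 2 ^ S -> logn 2 z < S.
  move=> z0 zS; rewrite -(ltn_exp2l _ _ (ltnSn 1)); apply: leq_ltn_trans zS.
  by apply: dvdn_leq => //; apply: pfactor_dvdnn.
have y0 : 0 < y by lia.
have [p ex nx] := dec x x0; have [q ey ny] := dec y y0.
have [xy'|yx'] := leqP (logn 2 x) (logn 2 y).
  exists (Ordinal (lt y y0 yS)) => /=; apply/orP; left; apply/eqP.
  have := h (logn 2 y).+1; rewrite /split_at nx ?ny //= -leqNgt => le.
  have {}le : x %/ 2 ^ (logn 2 y).+1 = y %/ 2 ^ (logn 2 y).+1.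
    by apply/eqP; rewrite eqn_leq le leq_div2r // ltnW.
  rewrite /lift_to le {1}ey; congr (_ * _ + _).
  by rewrite {1}ey divnMDl ?expn_gt0 // divn_small ?addn0 // ltn_exp2l.
exists (Ordinal (lt x x0 (ltn_trans xy yS))) => /=; apply/orP; right; apply/eqP.
have := h (logn 2 x).+1; rewrite /split_at ny ?nx //=; last by lia.
rewrite -leqNgt => le.
have {}le : y %/ 2 ^ (logn 2 x).+1 = x %/ 2 ^ (logn 2 x).+1.
  by apply/eqP; rewrite eqn_leq le leq_div2r // ltnW.
rewrite /lift_to le {1}ex; congr (_ * _ + _).
by rewrite {1}ex divnMDl ?expn_gt0 // divn_small ?addn0 // ltn_exp2l.
Qed.

Definition nloc_count d :=
  \sum_(x < d.+1) \sum_(y < d.+1) ([&& 0 < x, x < y & ~~ loc x y] : nat).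

Lemma nloc_count_succ d : nloc_count d.+1 <= nloc_count d + d.+1.
Proof.
rewrite /nloc_count big_ord_recr /= [X in _ + X]big1 ?addn0; last first.
  by move=> y _; case: ltngtP (ltn_ord y) => //; rewrite ?andbF // ltnS leqNgt => ->.
under eq_bigr => x _ do rewrite big_ord_recr /=.
rewrite big_split leq_add2l /=.
apply: (@leq_trans (\sum_(x < d.+1) 1)); last by rewrite sum_nat_const card_ord muln1.
by apply: leq_sum => x _; apply: leq_b1.
Qed.

Lemma loc_count_le d S : d < 2 ^ S ->
  \sum_(x < d.+1) \sum_(y < d.+1) ((0 < x) && loc x y : nat) <= 2 * d.+1 * S.
Proof.
move=> dS.
apply: (@leq_trans (\sum_(x < d.+1) \sum_(y < d.+1) \sum_(r < S)
   ((y == lift_to r x :> nat) + (x == lift_to r y :> nat)))).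
  apply: leq_sum => x _; apply: leq_sum => y _.
  case: (boolP ((0 < x) && loc x y)) => // /andP[x0 lxy].
  have yS : y < 2 ^ S by apply: leq_ltn_trans dS; rewrite -ltnS.
  have [r rP] := loc_lift x0 yS lxy.
  rewrite (bigD1 r) //= -[X in X <= _]addn0 leq_add //.
  by case/orP: rP => ->; rewrite ?addn1.
have le1 a : \sum_(y < d.+1) (y == a :> nat : nat) <= 1.
  have [ad|da] := leqP a d; first by rewrite sum_eq_ord.
  by rewrite big1 // => y _; case: eqP => // e; have := ltn_ord y; lia.
have le2 (G : nat -> nat -> nat) : 
    \sum_(x < d.+1) \sum_(y < d.+1) \sum_(r < S) (y == G r x :> nat : nat) <= d.+1 * S.
  apply: (@leq_trans (\sum_(x < d.+1) S)); last by rewrite sum_nat_const card_ord.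
  apply: leq_sum => x _; rewrite exchange_big /=.
  apply: (@leq_trans (\sum_(r < S) 1)); last by rewrite sum_nat_const card_ord muln1.
  by apply: leq_sum => r _; apply: le1.
under eq_bigr => x _ do under eq_bigr => y _ do rewrite big_split.
under eq_bigr => x _ do rewrite big_split.
rewrite big_split /= -mulnA mul2n -addnn leq_add //.
by rewrite exchange_big; apply: (le2 lift_to).
Qed.

Lemma nloc_count_ge d S : d < 2 ^ S -> d * d.-1 <= 2 * nloc_count d + 4 * d.+1 * S.
Proof.
move=> dS; have := loc_count_le dS.
have : \sum_(x < d.+1) \sum_(y < d.+1) ((0 < x) && (x < y) : nat) <=
  nloc_count d + \sum_(x < d.+1) \sum_(y < d.+1) ((0 < x) && loc x y : nat).
  rewrite /nloc_count -big_split; apply: leq_sum => x _.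
  rewrite -big_split; apply: leq_sum => y _ /=.
  by case: (0 < x); case: (x < y); case: (loc x y).
suff <- : (\sum_(x < d.+1) \sum_(y < d.+1) ((0 < x) && (x < y) : nat)) * 2 = d * d.-1.
  by lia.
elim: d {dS} => [|d IH]; first by rewrite !big_ord_recr !big_ord0.
rewrite big_ord_recr /= [X in _ + X]big1 ?addn0; last first.
  by move=> y _; case: ltngtP (ltn_ord y) => //; rewrite ?andbF // ltnS leqNgt => ->.
under eq_bigr => x _ do rewrite big_ord_recr /= ltn_ord andbT.
by rewrite big_split /= (@sum_ge_ord d 1) // mulnDl IH; case: (d) => // k; lia.
Qed.

(** * Orientations *)

(* k comes strictly between i and j on the way from i to j in the cyclic order. *)
Definition btw i k j := [|| i < k < j, k < j < i | j < i < k].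

Definition hop N (e : rel nat) i j :=
  exists k, [/\ k <= N, btw i k j, e i k & e k j].

Definition unjoined N (e : rel nat) : rel nat :=
  fun a b => [&& a < b, b <= N, ~~ e a b & ~~ e b a].

Section Orientation.

Variables (N : nat) (e : rel nat).
Hypothesis N0 : 1 < N.
Hypothesis e_succ : forall i, i < N -> e i i.+1.
Hypothesis e_wrap : e N 0.
Hypothesis e_asym : forall i j, i <= N -> j <= N -> e i j -> ~~ e j i.
Hypothesis e_acyclic3 : forall i j k, i <= N -> j <= N -> k <= N ->
  e i j -> e j k -> ~~ e k i.
Hypothesis e_hop : forall i j, i <= N -> j <= N -> e i j ->
  [\/ j = i.+1, i = N /\ j = 0 | hop N e i j].

Lemma unjoined_diags : diags N (unjoined N e).
Proof.
move=> a b /and4P[ab bN n1 n2]; split => //.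
  have [ba|//] := leqP b a.+1; have eb : b = a.+1 by lia.
  by move: n1; rewrite eb e_succ // -eb.
by apply: contra n2 => /andP[/eqP-> /eqP->].
Qed.

(** Descent from the root arc [N -> 0]. The triangle on a side with a backward arc [j -> i] is not
    directed, so one of its two other sides carries a backward arc too. The descent cannot end,
    because boundary edges point forward. *)
Lemma unjoined_ntr : ~ tr (allow (unjoined N e)) 0 N.
Proof.
suff H i j : tr (allow (unjoined N e)) i j -> j <= N -> e j i -> False.
  by move=> /H; apply.
elim=> {i j} [i|i k j Rik Rkj t1 IH1 t2 IH2] jN.
  by move=> h; have := e_asym (ltnW jN) jN (e_succ jN); rewrite h.
have ik := tr_lt t1; have kj := tr_lt t2.
have iN : i <= N by lia.
have kN : k <= N by lia.
move=> eji; move: Rik Rkj.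
rewrite /allow /unjoined ik kj jN kN /= -!negb_or !negbK.
case/orP => [eik|/(IH1 kN) //]; case/orP => [ekj|/(IH2 jN) //].
by have := e_acyclic3 iN kN jN eik ekj; rewrite eji.
Qed.

Lemma arc_inner i j : i < j <= N -> e i j -> tr (allow (unjoined N e)) i j.
Proof.
have [m] := ubnP (j - i); elim: m i j => // m IH i j jim /andP[ij jN] eij.
have iN : i <= N by lia.
have [->|[_ j0]|[k [kN ikj eik ekj]]] := e_hop iN jN eij; first exact: tr_edge.
  by move: ij; rewrite j0.
have {}ikj : i < k < j by move: ikj; rewrite /btw; lia.
by apply: (tr_split (k := k)); try (apply: IH => //; lia);
   rewrite /allow /unjoined ?eik ?ekj !andbF.
Qed.

(** The triangulated interval grows outwards: the bypass [k] of the arc [j -> i] lies outside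
    [i..j], and the newly covered stretch is filled by [arc_inner]. Growth stops only at the arc
    [N -> 0]. *)
Lemma arc_outer (R : rel nat) i j : subrel (allow (unjoined N e)) R ->
  i < j <= N -> e j i -> R i j -> tr R i j -> tr R 0 N.
Proof.
move=> sub; have [m] := ubnP (N + i - j).
elim: m i j => // m IH i j jim /andP[ij jN] eji Rij t.
have iN : i <= N by lia.
have [ei|[j1 i0]|[k [kN jki ejk eki]]] := e_hop jN iN eji; first by lia.
  by move: t; rewrite j1 i0.
have al a b : e a b || e b a -> R a b.
  by move=> h; apply: sub; move: h; rewrite /allow /unjoined; do 2!case: (e _ _); rewrite ?andbF.
have [kl|kg] : k < i \/ j < k by move: jki; rewrite /btw; lia.
  apply: (IH k j) => //; try lia; first by apply: al; rewrite ejk orbT.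
  apply: (tr_split (k := i)) => //; first by apply: al; rewrite eki.
  by apply: tr_mono sub _; apply: arc_inner => //; lia.
apply: (IH i k) => //; try lia; first by apply: al; rewrite eki orbT.
apply: (tr_split (k := j)) => //; first by apply: al; rewrite ejk.
by apply: tr_mono sub _; apply: arc_inner => //; lia.
Qed.

(** The bypasses [k] and [l] are the apexes of the two triangles on [(i,j)]; the rest is filled
    along arcs, so [(i,j)] is the only blocked chord in use. *)
Lemma hop_essential i j : i < j <= N -> hop N e i j -> hop N e j i ->
  tr (allow1 (unjoined N e) i j) 0 N.
Proof.
move=> /andP[ij jN] [k [kN ikj eik ekj]] [l [lN jli ejl eli]].
set R := allow1 _ i j.
have sub : subrel (allow (unjoined N e)) R by move=> a b; rewrite /R /allow /allow1 => ->.
have al a b : e a b || e b a -> R a b.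
  by move=> h; apply: sub; move: h; rewrite /allow /unjoined; do 2!case: (e _ _); rewrite ?andbF.
have inn a b : a < b <= N -> e a b -> tr R a b.
  by move=> ab eab; apply: tr_mono sub _; apply: arc_inner.
have {}ikj : i < k < j by move: ikj; rewrite /btw; lia.
have t : tr R i j.
  apply: (tr_split (k := k)); try (by apply: al; rewrite ?eik ?ekj);
  by apply: inn => //; lia.
have Rij : R i j by rewrite /R /allow1 !eqxx orbT.
have [ll|lg] : l < i \/ j < l by move: jli; rewrite /btw; lia.
  apply: (@arc_outer R l j) => //; try lia; first by apply: al; rewrite ejl orbT.
  apply: (tr_split (k := i)) => //; first by apply: al; rewrite eli.
  by apply: inn => //; lia.
apply: (@arc_outer R i l) => //; try lia; first by apply: al; rewrite eli orbT.
apply: (tr_split (k := j)) => //; first by apply: al; rewrite ejl.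
by apply: inn => //; lia.
Qed.

End Orientation.

(** * Cuts of the points and the orientation with hubs *)

Section Cuts.

Variable d : nat.

(* Cut number s is a maximal pair of disjoint sets Y, X without loc-arc from Y to X. *)
Definition Yset s x := ~~ right s x && all (fun y => right s y ==> ~~ loc x y) (iota 1 d).
Definition Xset s x := ~~ Yset s x && all (fun y => Yset s y ==> ~~ loc y x) (iota 1 d).

Lemma XsetNY s x : Xset s x -> ~~ Yset s x. Proof. by case/andP. Qed.

Lemma YX_nloc s x y : 0 < x <= d -> Yset s x -> Xset s y -> ~~ loc x y.
Proof.
move=> xd Yx /andP[_ /allP/(_ x)]; rewrite mem_iota Yx; apply.
by rewrite add1n ltnS.
Qed.

Lemma left_Y s x : left s x -> Yset s x.
Proof.
move=> lx; apply/andP; split; first by move: lx; rewrite /left /right; do 2!case: (~~ _).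
by apply/allP => y _; apply/implyP => ry; apply/negP => /left_right_loc/(_ lx ry).
Qed.

Lemma right_X s x : 0 < x <= d -> right s x -> Xset s x.
Proof.
move=> xd rx; apply/andP; split; first by rewrite /Yset rx.
apply/allP => y _; apply/implyP => /andP[_ /allP/(_ x)].
by rewrite mem_iota add1n ltnS xd rx; apply.
Qed.

(** Maximality of the cut: a point left out of both sides has an arc from [Y] and an arc to [X],
    which provide its bypasses from and to [Mid s]. *)
Lemma neither_XY s x : 0 < x <= d -> ~~ Xset s x -> ~~ Yset s x ->
  (exists i, [/\ 0 < i <= d, Yset s i & loc i x]) /\
  (exists j, [/\ 0 < j <= d, Xset s j & loc x j]).
Proof.
move=> xd nX nY; split.
  move: nX; rewrite /Xset nY => /allPn[i]; rewrite mem_iota add1n ltnS negb_imply negbK.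
  by move=> ? /andP[? ?]; exists i.
move: nY; rewrite /Yset negb_and negbK; case/orP => [/(right_X xd) h|].
  by rewrite h in nX.
case/allPn => j; rewrite mem_iota add1n ltnS negb_imply negbK => jd /andP[rj ?].
by exists j; split => //; apply: right_X.
Qed.

Lemma XY_cut S x y : d < 2 ^ S -> 0 < x -> x < y <= d -> ~~ loc x y ->
  exists s, [/\ s < S, Yset s x & Xset s y].
Proof.
move=> dS x0 /andP[xy yd] /(nloc_cut xy)[s [lx ry sy]]; exists s; split.
- by rewrite -(ltn_exp2l _ _ (ltnSn 1)); lia.
- exact: left_Y.
- by apply: right_X => //; lia.
Qed.

End Cuts.

(* Cyclic order of the vertices: Z0, the points Pt 1, ..., Pt d, Z1, then for each
   scale s the hubs In s, Mid s, Out s. The arcs x -> Mid s for x in X and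
   Mid s -> x for x in Y bypass every pair separated by cut s from behind. *)
Inductive kind := Z0 | Pt of nat | Z1 | In of nat | Mid of nat | Out of nat.

Section Dense.

Variables (d S : nat).
Hypothesis dS : d < 2 ^ S.
Hypothesis S0 : 0 < S.
Hypothesis d0 : 0 < d.

Let N := d + 1 + 3 * S.
Notation X := (Xset d).
Notation Y := (Yset d).

Definition pos v :=
  match v with
  | Z0 => 0 | Pt x => x | Z1 => d.+1
  | In s => d + 2 + 3 * s | Mid s => d + 3 + 3 * s | Out s => d + 4 + 3 * s
  end.

Definition valid v :=
  match v with
  | Z0 | Z1 => true | Pt x => 0 < x <= d | In s | Mid s | Out s => s < S
  end.

Definition kind_of p :=
  if p == 0 then Z0 else if p <= d then Pt p else if p == d.+1 then Z1 else
  let q := p - (d + 2) in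
  match q %% 3 with 0 => In (q %/ 3) | 1 => Mid (q %/ 3) | _ => Out (q %/ 3) end.

(** An arc [x -> In s] with [x] in [Y] would close the directed triangle [x], [In s], [Mid s], and
    an arc [Out s -> x] with [x] in [X] the triangle [x], [Mid s], [Out s]. Hence [In s] and [Out s]
    are joined to the complements of [Y] and [X]. *)
Definition arc u v :=
  match u, v with
  | Z0, Pt _ => true
  | Pt x, Pt y => loc x y
  | Pt _, Z1 => true
  | Pt x, In s => ~~ Y s x
  | Pt x, Mid s => X s x
  | Z1, In _ => true
  | In s, Mid t => t == s
  | In s, In t => t == s.+1
  | Mid s, Out t => t == s
  | Mid s, Pt x => Y s x
  | Mid s, In t => t == s.+1
  | Out s, In t => t == s.+1
  | Out s, Mid t => t == s.+1
  | Out s, Out t => t == s.+1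
  | Out _, Z0 => true
  | Out s, Pt x => ~~ X s x
  | _, _ => false
  end.

Definition dense_arc : rel nat := fun a b => arc (kind_of a) (kind_of b).

Lemma kind_ofK v : valid v -> kind_of (pos v) = v.
Proof.
rewrite /kind_of; case: v => [|x||s|s|s] //=; first by case: x => [|x] //= ->.
- by rewrite ltnn eqxx.
- move=> _; rewrite !ifF; try lia.
  have -> : (d + 2 + 3 * s - (d + 2)) = s * 3 + 0 by lia.
  by rewrite modnMDl divnMDl // addn0.
- move=> _; rewrite !ifF; try lia.
  have -> : (d + 3 + 3 * s - (d + 2)) = s * 3 + 1 by lia.
  by rewrite modnMDl divnMDl // addn0.
- move=> _; rewrite !ifF; try lia.
  have -> : (d + 4 + 3 * s - (d + 2)) = s * 3 + 2 by lia.
  by rewrite modnMDl divnMDl // addn0.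
Qed.

Lemma posP p : p <= N -> exists2 v, valid v & p = pos v.
Proof.
rewrite /N => pN; have [->|p0] := posnP p; first by exists Z0.
have [pd|pd] := leqP p d; first by exists (Pt p) => //=; rewrite p0 pd.
have [->|p1] := eqVneq p d.+1; first by exists Z1.
pose q := p - (d + 2); have := divn_eq q 3; have := ltn_pmod q (isT : 0 < 3).
set a := q %/ 3; case: (q %% 3) => [|[|[|//]]] _ e; rewrite /q in e.
- by exists (In a) => /=; lia.
- by exists (Mid a) => /=; lia.
- by exists (Out a) => /=; lia.
Qed.

Lemma pos_le v : valid v -> pos v <= N.
Proof. by rewrite /N; case: v => /=; lia. Qed.

Lemma hop_kind u v w : valid u -> valid v -> valid w ->
  btw (pos u) (pos v) (pos w) -> arc u v -> arc v w -> hop N dense_arc (pos u) (pos w).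
Proof.
move=> uv vv wv b a1 a2; exists (pos v); split => //; first exact: pos_le.
  by rewrite /dense_arc !kind_ofK.
by rewrite /dense_arc !kind_ofK.
Qed.

Lemma arc_asym u v : arc u v -> ~~ arc v u.
Proof.
case: u v => [|x||s|s|s] [|y||t|t|t] //=; try lia.
- by move=> /loc_lt xy; apply/negP => /loc_lt; lia.
- by move=> /XsetNY.
- by apply: contraL => /XsetNY.
Qed.

Lemma arc_acyclic3 u v w : valid u -> valid v -> valid w ->
  arc u v -> arc v w -> ~~ arc w u.
Proof.
case: u v w => [|x||s|s|s] [|y||t|t|t] [|z||r|r|r] //=; try lia.
- move=> _ _ _ /loc_lt xy /loc_lt yz; apply/negP => /loc_lt; lia.
- by move=> xd _ _ lxy Xy; apply/negP => Yx; move: (YX_nloc xd Yx Xy); rewrite lxy.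
- by move=> _ _ _ nY /eqP->.
- by move=> _ _ zd Xx Yz; apply: YX_nloc zd Yz Xx.
- by move=> _ _ _ Xx /eqP->; rewrite negbK.
- by move=> _ _ _ /eqP-> Yz; rewrite negbK.
- by move=> _ yd _ Yy lyz; apply/negP => Xz; move: (YX_nloc yd Yy Xz); rewrite lyz.
- by move=> _ _ _ Ys nY; apply: contra nY => /eqP<-.
- by move=> _ _ _ /eqP->.
- by move=> _ _ _ nX Xr; apply: contra nX => /eqP->.
Qed.

Lemma arc_hop u w : valid u -> valid w -> arc u w ->
  [\/ pos w = (pos u).+1, pos u = N /\ pos w = 0 | hop N dense_arc (pos u) (pos w)].
Proof.
case: u w => [|x||s|s|s] [|y||t|t|t] // uv wv a.
- have [y1|y1] := leqP y 1; first by constructor 1; move: wv => /=; lia.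
  by constructor 3; apply: (@hop_kind _ (Pt y.-1)) => //=;
    rewrite -?{4}(prednK (ltnW y1)) ?/btw /= ?(prednK (ltnW y1)); move: wv => /= ?; try lia;
    rewrite -[X in loc _ X](prednK (ltnW y1)) loc_succ.
- have [yx|yx] := leqP y x.+1.
    by constructor 1 => /=; have /= := loc_lt a; lia.
  have [k [kxy l1 l2]] := loc_hop yx; constructor 3; apply: (@hop_kind _ (Pt k)) => //=.
    by move: uv wv => /=; lia.
  by rewrite /btw /= kxy.
- have [xd|xd] := leqP d x; first by constructor 1; move: uv => /=; lia.
  constructor 3; apply: (@hop_kind _ (Pt x.+1)) => //=; rewrite ?loc_succ //.
  by rewrite /btw /=; lia.
- constructor 3; apply: (@hop_kind _ Z1) => //=.
  by move: uv; rewrite /btw /=; lia.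
(* A point of [X] is outside [Y], so its arc to [Mid t] is bypassed by [In t]; dually, arcs from
   [Mid s] to [Y] are bypassed by [Out s]. *)
- constructor 3; apply: (@hop_kind _ (In t)) => //=; first last.
  + exact: XsetNY.
  + by move: uv; rewrite /btw /=; lia.
- case: t wv a => [|t] wv _; first by constructor 1; rewrite /=; lia.
  constructor 3; apply: (@hop_kind _ (In t)) => //=; first by move: wv => /=; lia.
  by rewrite /btw /=; lia.
- move: a wv => /= /eqP-> wv; constructor 3; apply: (@hop_kind (In s) (Mid s) (In s.+1)) => //=.
  by rewrite /btw /=; lia.
- by move: a => /= /eqP->; constructor 1; lia.
- constructor 3; apply: (@hop_kind _ (Out s)) => //=; first last.
  + by apply: contraL a => /= /XsetNY.
  + by move: wv; rewrite /btw /=; lia.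
- move: a wv => /= /eqP-> wv; constructor 3; apply: (@hop_kind (Mid s) (Out s) (In s.+1)) => //=.
  by rewrite /btw /=; lia.
- by move: a => /= /eqP->; constructor 1; lia.
- have [sS|sS] := leqP S s.+1.
    by constructor 2; rewrite /N; move: uv => /=; lia.
  constructor 3; apply: (@hop_kind _ (Out s.+1)) => //=.
  by rewrite /btw /=; lia.
- constructor 3; apply: (@hop_kind _ Z0) => //=.
  by move: wv; rewrite /btw /=; lia.
- by move: a => /= /eqP->; constructor 1; lia.
- move: a wv => /= /eqP-> wv; constructor 3; apply: (@hop_kind (Out s) (In s.+1) (Mid s.+1)) => //=.
  by rewrite /btw /=; lia.
- move: a wv => /= /eqP-> wv; constructor 3; apply: (@hop_kind (Out s) (Mid s.+1) (Out s.+1)) => //=.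
  by rewrite /btw /=; lia.
Qed.

(* Only the O(S^2) chords between hubs stay undecided when passing to a minimal
   blocker. *)
Lemma pt_hop x w : 0 < x <= d -> valid w -> w <> Pt x -> ~~ arc (Pt x) w -> ~~ arc w (Pt x) ->
  hop N dense_arc x (pos w) /\ hop N dense_arc (pos w) x.
Proof.
move=> xd; have vx : valid (Pt x) by [].
have pts y z : 0 < y -> y < z <= d -> ~~ loc y z ->
    hop N dense_arc y z /\ hop N dense_arc z y.
  (* The forward bypass is a point between [y] and [z]; the way back leads through the hub [Mid s]
     of a cut separating them. *)
  move=> y0 /andP[yz zd] nl; have [s [sS Yy Xz]] := XY_cut dS y0 (introT andP (conj yz zd)) nl.
  have [k [kyz l1 l2]] : exists k, [/\ y < k < z, loc y k & loc k z].
    apply: loc_hop; rewrite ltn_neqAle yz andbT; apply: contra nl => /eqP<-; exact: loc_succ.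
  split.
    by apply: (@hop_kind (Pt y) (Pt k) (Pt z)) => //=; try lia; rewrite /btw /= kyz.
  by apply: (@hop_kind (Pt z) (Mid s) (Pt y)) => //=; try lia; rewrite /btw /=; lia.
case: w => [|y||s|s|s] //= wv nw n1 n2.
- have [xy|yx|e] := ltngtP x y; last by case: nw; rewrite e.
    by apply: pts => //; lia.
  by have [] := pts y x _ _ n2 => //; lia.
- rewrite negbK in n1; split.
    by apply: (@hop_kind (Pt x) Z1 (In s)) => //=; rewrite /btw /=; lia.
  by apply: (@hop_kind (In s) (Mid s) (Pt x)) => //=; rewrite /btw /=; lia.
- have [[i [id Yi il]] [j [jd Xj lj]]] := neither_XY xd n1 n2; split.
    by apply: (@hop_kind (Pt x) (Pt j) (Mid s)) => //=; have := loc_lt lj; rewrite /btw /=; lia.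
  by apply: (@hop_kind (Mid s) (Pt i) (Pt x)) => //=; have := loc_lt il; rewrite /btw /=; lia.
- rewrite negbK in n2; split.
    by apply: (@hop_kind (Pt x) (Mid s) (Out s)) => //=; rewrite /btw /=; lia.
  by apply: (@hop_kind (Out s) Z0 (Pt x)) => //=; rewrite /btw /=; lia.
Qed.

End Dense.

(** * Counting in the dense blockers *)

Lemma sum_ord_cat a b (F : nat -> nat) :
  \sum_(y < a + b) F y = \sum_(y < a) F y + \sum_(y < b) F (a + y).
Proof. by rewrite big_split_ord. Qed.

Lemma sum_ord_triples S (F : nat -> nat) :
  \sum_(y < 1 + 3 * S) F y =
  F 0 + \sum_(s < S) (F (1 + 3 * s) + F (2 + 3 * s) + F (3 + 3 * s)).
Proof.
elim: S => [|S IH]; first by rewrite muln0 big_ord1 big_ord0 [RHS]addn0.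
have -> : 1 + 3 * S.+1 = (1 + 3 * S).+3 by lia.
do 3 rewrite [in LHS]big_ord_recr; rewrite [in RHS]big_ord_recr /= IH -!addnA; do 2 congr (_ + _).
Qed.

(** Position 0 is the vertex [Z0], with arcs to all points; since [loc] agrees, [nadj] is also
    correct at 0. *)
Lemma loc0n x : 0 < x -> loc 0 x.
Proof. by move=> x0; apply/locP; split => // s; rewrite /split_at dvdn0. Qed.

Section DenseCount.

Variables (d S : nat).
Hypothesis dS : 2 ^ S.-1 <= d < 2 ^ S.
Hypothesis S0 : 0 < S.

Let N := d + 1 + 3 * S.
Let e := dense_arc d.
Let U := unjoined N e.

Let d0 : 0 < d.
Proof. by case/andP: dS => + _; apply: leq_trans; rewrite expn_gt0. Qed.

Let N1 : 1 < N. Proof. by rewrite /N; lia. Qed.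

Let dlt : d < 2 ^ S. Proof. by case/andP: dS. Qed.

Lemma dense_arc_pos u v : valid d S u -> valid d S v -> e (pos d u) (pos d v) = arc d u v.
Proof. by move=> uv vv; rewrite /e /dense_arc !(kind_ofK dlt S0 d0). Qed.

Lemma dense_succ i : i < N -> e i i.+1.
Proof.
move=> iN; have [v vv iv] := posP dlt S0 d0 (ltnW iN).
have step w : valid d S w -> i.+1 = pos d w -> arc d v w -> e i i.+1.
  by move=> vw -> a; rewrite iv dense_arc_pos.
case: v vv iv step => [|x||s|s|s] /= vv iv step.
- by apply: (step (Pt 1)) => //=; lia.
- have [xd|xd] := ltnP x d.
    by apply: (step (Pt x.+1)); rewrite /= ?loc_succ //; lia.
  by apply: (step Z1) => //=; lia.
- by apply: (step (In 0)) => //=; lia.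
- by apply: (step (Mid s)) => //=; lia.
- by apply: (step (Out s)) => //=; lia.
- by apply: (step (In s.+1)) => //=; rewrite /N in iN; lia.
Qed.

Lemma dense_wrap : e N 0.
Proof.
have -> : N = pos d (Out S.-1) by rewrite /= /N; lia.
by rewrite -[0]/(pos d Z0) dense_arc_pos //=; lia.
Qed.

Lemma dense_asym i j : i <= N -> j <= N -> e i j -> ~~ e j i.
Proof. by move=> _ _; apply: (arc_asym dlt S0 d0). Qed.

Lemma dense_acyclic3 i j k : i <= N -> j <= N -> k <= N ->
  e i j -> e j k -> ~~ e k i.
Proof.
move=> iN jN kN.
have [u vu ->] := posP dlt S0 d0 iN; have [v vv ->] := posP dlt S0 d0 jN.
have [w vw ->] := posP dlt S0 d0 kN; rewrite !dense_arc_pos //.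
exact: (arc_acyclic3 dlt S0 d0 vu).
Qed.

Lemma dense_hop i j : i <= N -> j <= N -> e i j ->
  [\/ j = i.+1, i = N /\ j = 0 | hop N e i j].
Proof.
move=> iN jN; have [u vu ->] := posP dlt S0 d0 iN; have [v vv ->] := posP dlt S0 d0 jN.
by rewrite dense_arc_pos //; apply: (arc_hop dlt S0 d0).
Qed.

Lemma dense_essential x y : 0 < x <= d -> y <= N ->
  (U x y -> tr (allow1 U x y) 0 N) /\ (U y x -> tr (allow1 U y x) 0 N).
Proof.
move=> xd yN.
have ess := hop_essential N1 dense_wrap dense_hop.
have [w vw yw] := posP dlt S0 d0 yN.
have vx : valid d S (Pt x) by [].
have := dense_arc_pos vx vw; have := dense_arc_pos vw vx; rewrite -yw /= => e1 e2.
have key : x != y -> ~~ e x y -> ~~ e y x -> hop N e x y /\ hop N e y x.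
  move=> xy; rewrite e1 e2 => n1 n2; rewrite yw; apply: (pt_hop dlt S0 d0) => //.
  by move=> wx; move: xy; rewrite yw wx eqxx.
split => /and4P[lt leN n1 n2].
  by have [||| h1 h2] := key => //; [lia|apply: ess => //; lia].
by have [||| h1 h2] := key => //; [lia|apply: ess => //; lia].
Qed.

Section Sub.

Variable B : rel nat.
Hypothesis satB : sat N B.
Hypothesis BU : subrel B U.
Hypothesis essB : forall x y, U x y -> tr (allow1 U x y) 0 N -> B x y.

Lemma dense_sub x y : 0 < x <= d -> y <= N -> B x y = U x y /\ B y x = U y x.
Proof.
move=> xd yN; have [h1 h2] := dense_essential xd yN.
split; apply/idP/idP => h; try exact: BU; apply: essB => //.
  exact: h1.
exact: h2.
Qed.

Lemma dense_adj x y : 0 < x <= d -> y <= N ->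
  adj B x y = [&& y != x, ~~ e x y & ~~ e y x] :> nat.
Proof.
move=> xd yN; have [h1 h2] := dense_sub xd yN; rewrite /adj h1 h2 /U /unjoined.
have xN : x <= N by rewrite /N; lia.
rewrite xN yN /=; case: ltngtP => //=; first by rewrite addn0.
by rewrite add0n andbC.
Qed.

Lemma dense_low x y : 0 < x <= d -> y <= d -> adj B x y = nadj x y.
Proof.
move=> xd yd; rewrite dense_adj //; last by rewrite /N; lia.
have vx : valid d S (Pt x) by [].
rewrite /nadj; case: y yd => [|y] yd.
  rewrite -[x]/(pos d (Pt x)) -[0]/(pos d Z0) !dense_arc_pos //= andbF.
  by rewrite loc0n ?andbF //; case/andP: xd.
by rewrite -[x]/(pos d (Pt x)) -[y.+1]/(pos d (Pt y.+1)) !dense_arc_pos.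
Qed.

(** A point is unjoined to exactly one hub of each scale: [Out s] if it lies in [X], [In s] if it
    lies in [Y], and [Mid s] otherwise. *)
Lemma dense_high x : 0 < x <= d -> \sum_(y < 1 + 3 * S) adj B x (d.+1 + y) = S.
Proof.
move=> xd; have vx : valid d S (Pt x) by [].
have F w : valid d S w -> w <> Pt x ->
    adj B x (pos d w) = ~~ arc d (Pt x) w && ~~ arc d w (Pt x) :> nat.
  move=> vw wx; rewrite dense_adj //; last exact: (pos_le dlt S0 d0).
  rewrite -[x]/(pos d (Pt x)) !dense_arc_pos //.
  suff -> : pos d w != pos d (Pt x) by [].
  apply/eqP => h; apply: wx.
  by rewrite -(kind_ofK dlt S0 d0 vw) h (kind_ofK dlt S0 d0).
rewrite (sum_ord_triples S (fun y => adj B x (d.+1 + y))) addn0.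
rewrite -[d.+1]/(pos d Z1) F //= add0n.
rewrite (eq_bigr (fun=> 1)) ?sum_nat_const ?card_ord ?muln1 // => s _.
have -> : d.+1 + (1 + 3 * s) = pos d (In s) by rewrite /=; lia.
have -> : d.+1 + (2 + 3 * s) = pos d (Mid s) by rewrite /=; lia.
have -> : d.+1 + (3 + 3 * s) = pos d (Out s) by rewrite /=; lia.
rewrite !F //=; have := @XsetNY d s x.
by case: (Xset d s x) => [/(_ isT)|_]; case: (Yset d s x).
Qed.

Lemma dense_deg x : 0 < x <= d -> deg N B x = \sum_(y < d.+1) (nadj x y : nat) + S.
Proof.
move=> xd; rewrite /deg -(dense_high xd).
rewrite (_ : N.+1 = d.+1 + (1 + 3 * S)); last by rewrite /N; lia.
rewrite (sum_ord_cat _ _ (fun y => adj B x y)); congr (_ + _).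
by apply: eq_bigr => y _; apply: dense_low => //; rewrite -ltnS.
Qed.

(** The exact part counts the unjoined pairs of points and [S] chords from each point to the hubs.
    The error bounds the chords from [Z0] and those among [Z1] and the hubs, whose survival in [B]
    is not determined. *)
Lemma dense_cnt :
  nloc_count d + d * S <= cnt N B <= nloc_count d + d * S + (3 * S + 2) ^ 2.
Proof.
have [dB _ _] := satB.
pose M := 1 + 3 * S.
have lt x y : B x y -> x < y by move=> /dB[]; lia.
have low x y : x <= d -> y <= d -> B x y = [&& 0 < x, x < y & ~~ loc x y].
  move=> xd yd; have yN : y <= N by rewrite /N; lia.
  have [x0|x0] := posnP x.
    apply/negP => /BU; rewrite x0 => /and4P[y0 _ /negP h _]; apply: h.
    have vy : valid d S (Pt y) by rewrite /= y0.
    by rewrite -[y]/(pos d (Pt y)) -[0]/(pos d Z0) dense_arc_pos.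
  have xd' : 0 < x <= d by rewrite x0.
  have [-> _] := dense_sub xd' yN; rewrite /U /unjoined yN /=.
  have [xy|//] := ltnP x y; have vx : valid d S (Pt x) by [].
  have vy : valid d S (Pt y) by rewrite /=; lia.
  rewrite -[x]/(pos d (Pt x)) -[y]/(pos d (Pt y)) !dense_arc_pos //=.
  suff -> : loc y x = false by rewrite andbT.
  by apply/negP => /loc_lt; lia.
have high x : 0 < x <= d -> \sum_(y < M) (B x (d.+1 + y) : nat) = S.
  move=> xd; rewrite -(dense_high xd); apply: eq_bigr => y _; rewrite /adj.
  suff -> : B (d.+1 + y) x = false by rewrite addn0.
  by apply/negP => /lt; lia.
have NM : N.+1 = d.+1 + M by rewrite /N /M; lia.
have -> : cnt N B = nloc_count d + (\sum_(y < M) (B 0 (d.+1 + y) : nat) + d * S)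
    + \sum_(x < M) \sum_(y < M) (B (d.+1 + x) (d.+1 + y) : nat).
  rewrite /cnt NM (sum_ord_cat _ _ (fun x => \sum_(y < d.+1 + M) (B x y : nat))).
  congr (_ + _).
    under eq_bigr => x _ do rewrite (sum_ord_cat _ _ (fun y => B x y : nat)).
    rewrite big_split /=; congr (_ + _).
      apply: eq_bigr => x _; apply: eq_bigr => y _; rewrite low //; rewrite -ltnS //.
    rewrite big_ord_recl; congr (_ + _).
    rewrite (eq_bigr (fun=> S)) ?sum_nat_const ?card_ord // => i _.
    by apply: high; rewrite lift0 /=.
  apply: eq_bigr => x _; rewrite (sum_ord_cat _ _ (fun y => B (d.+1 + x) y : nat)).
  rewrite big1 // => y _; case: (boolP (B _ _)) => // /lt.
  by have := ltn_ord y; lia.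
have b1 (F : nat -> bool) : \sum_(y < M) (F y : nat) <= M.
  apply: (@leq_trans (\sum_(y < M) 1)); last by rewrite sum_nat_const card_ord muln1.
  by apply: leq_sum => y _; apply: leq_b1.
have c1 := b1 (fun y => B 0 (d.+1 + y)).
have c2 : \sum_(x < M) \sum_(y < M) (B (d.+1 + x) (d.+1 + y) : nat) <= M * M.
  apply: (@leq_trans (\sum_(x < M) M)); last by rewrite sum_nat_const card_ord.
  by apply: leq_sum => x _; apply: (b1 (fun y => B (d.+1 + x) (d.+1 + y))).
have : M + M * M <= (3 * S + 2) ^ 2 by rewrite /M; nia.
lia.
Qed.

End Sub.

(** The marked vertices are the powers [2 ^ r]. Any two of them are joined by [loc], hence
    non-adjacent in the blocker; their degrees come from [sum_nadj_exp2] and the [S] chords to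
    hubs. *)
Lemma dense_conf : exists2 t, nloc_count d + d * S <= t <= nloc_count d + d * S + (3 * S + 2) ^ 2
  & conf N t (fun _ _ : 'I_S.-1 => 0) (fun r => d + 2 + r - 2 ^ r.+1).
Proof.
have dU : diags N U := unjoined_diags N1 dense_succ dense_wrap.
have nU := unjoined_ntr N1 dense_succ dense_wrap dense_asym dense_acyclic3.
have [B [sB BU ess]] := sat_sub dU nU.
have pw (r : 'I_S.-1) : 0 < 2 ^ r <= d.
  rewrite expn_gt0 /=; case/andP: dS => h _; apply: leq_trans h.
  by rewrite leq_exp2l // ltnW.
exists (cnt N B); first exact: dense_cnt.
exists B, (fun r => 2 ^ r); split => //.
  move=> r; have xd := pw r; split; first by rewrite /N; lia.
  rewrite (dense_deg BU ess xd).
  have := sum_nadj_exp2 dS (ltn_ord r); set s := (\sum_(_ < _) _); set p := 2 ^ _.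
  by lia.
move=> r r'; have := pw r; have := pw r' => h' h.
rewrite (dense_low BU ess h); last by case/andP: h'.
rewrite /nadj; case: (ltngtP r r') => rr.
- by rewrite loc_exp2r ?ltn_exp2l ?andbF.
- by rewrite (@loc_exp2r r) ?ltn_exp2l ?andbF.
- by rewrite rr eqxx.
Qed.

End DenseCount.

(** * Attaining every size *)

(* Degree of the vertex 1 minus degree of the vertex 2^r in the dense blocker. *)
Definition gap r := 2 ^ r.+1 - (r + 2).

Lemma gap_succ r : gap r.+1 = 2 * gap r + r.+1.
Proof.
rewrite /gap expnS; have := ltn_expl r.+1 (ltnSn 1); set p := 2 ^ _.
by lia.
Qed.

Lemma gap_ge r : r <= gap r.
Proof. by elim: r => // r IH; rewrite gap_succ; lia. Qed.

(** Greedy expansion: a remainder below [gap R.+2] is at most [3 * gap R.+1], so each lower level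
    costs at most three terms. It ends exactly because [gap 1 = 1]. *)
Lemma gap_sums R K G : 0 < R -> G <= K * gap R -> exists w : seq nat,
  [/\ all (leq^~ R) w, size w <= K + 3 * R & \sum_(i <- w) gap i = G].
Proof.
elim: R K G => // -[|R] IH K G _ GK.
  exists (nseq G 1); rewrite size_nseq; split.
  - by apply/allP => i /nseqP[->].
  - by move: GK; rewrite /gap /=; lia.
  - by rewrite big_nseq; elim: (G) => //= g ->.
have g0 : 0 < gap R.+2 by rewrite gap_succ; lia.
have := divn_eq G (gap R.+2); have := ltn_pmod G g0.
set q := G %/ _; set r := G %% _ => rg e.
have qK : q <= K.
  rewrite -(leq_pmul2r g0); lia.
have r3 : r <= 3 * gap R.+1.
  by move: rg; rewrite (gap_succ R.+1); have := gap_ge R.+1; lia.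
have [w [wR ws wG]] := IH 3 r isT r3.
exists (nseq q R.+2 ++ w); split.
- rewrite all_cat; apply/andP; split; first by apply/allP => i /nseqP[->] /=.
  by apply: sub_all wR => i /=; lia.
- by rewrite size_cat size_nseq; lia.
- by rewrite big_cat big_nseq /= wG e; congr (_ + _); elim: (q) => //= k ->; rewrite mulSn.
Qed.

(** After the [d + 2 + 3 * s.+2] vertices of the dense blocker, [x] duplications remain. All at
    vertex 1, of degree [d], they give size [tau + x * d]; moving one of them to [2 ^ i] lowers the
    size by [gap i]. The overshoot above [t] is written as a sum of gaps, padded with
    [gap 0 = 0]. *)
Lemma dense_hit d s n t tau K : 2 ^ s.+1 <= d < 2 ^ s.+2 -> 0 < s ->
  conf (d + 1 + 3 * s.+2) tau (fun _ _ : 'I_s.+1 => 0) (fun r => d + 2 + r - 2 ^ r.+1) ->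
  d + 2 + 3 * s.+2 + K + 3 * s <= n ->
  t <= tau + (n - (d + 2 + 3 * s.+2)) * d <= t + K * gap s ->
  exists B : {set edge n}, nk_blocker t B.
Proof.
move=> /andP[ds _] s0 cf; set x := n - _ => nx /andP[tlo thi].
have [w [ws wsz wG]] : exists w : seq nat, [/\ all (leq^~ s) w, size w <= K + 3 * s &
    \sum_(i <- w) gap i = tau + x * d - t] by apply: gap_sums => //; lia.
pose w' := w ++ nseq (x - size w) 0.
have sz : size w' = x by rewrite size_cat size_nseq /x; lia.
have w's : all (leq^~ s) w' by rewrite all_cat ws; apply/allP => i /nseqP[->].
have w'G : \sum_(i <- w') gap i = tau + x * d - t.
  by rewrite big_cat /= wG [X in _ + X]big1_seq ?addn0 // => i /andP[_ /nseqP[->]].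
have N0 : 0 < d + 1 + 3 * s.+2 by lia.
have := conf_indep [seq inord i | i <- w'] N0 cf; rewrite size_map sz big_map.
have -> : \sum_(i <- w') (d + 2 + (inord i : 'I_s.+1) - 2 ^ (inord i : 'I_s.+1).+1)
    = x * d - (tau + x * d - t).
  suff : \sum_(i <- w') (d + 2 + (inord i : 'I_s.+1) - 2 ^ (inord i : 'I_s.+1).+1)
     + \sum_(i <- w') gap i = size w' * d by rewrite w'G sz => h; rewrite -[LHS](addnK (tau + x * d - t)) h.
  rewrite -big_split /= -sum1_size big_distrl /=; apply: eq_big_seq => i iw.
  have is' : i <= s by apply: (allP w's).
  rewrite inordK ?ltnS // mul1n /gap; have := ltn_expl i.+1 (ltnSn 1).
  have : 2 ^ i.+1 <= 2 ^ s.+1 by rewrite leq_exp2l.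
  move: (2 ^ i.+1) (2 ^ s.+1) ds => a b; lia.
have Gx : tau + x * d - t <= x * d.
  rewrite -w'G -sz -sum1_size big_distrl /= big_seq [X in _ <= X]big_seq.
  apply: leq_sum => i iw; have is' : i <= s by apply: (allP w's).
  have : 2 ^ i.+1 <= 2 ^ s.+1 by rewrite leq_exp2l.
  rewrite /gap; lia.
move=> /(conf_nk (ltn_addr _ N0)).
have -> : (d + 1 + 3 * s.+2 + x).+1 = n by rewrite /x; lia.
have -> : tau + (x * d - (tau + x * d - t)) = t by lia.
by [].
Qed.

Definition scale d := (trunc_log 2 d).+1.

Lemma scaleP d : 0 < d -> 2 ^ (scale d).-1 <= d < 2 ^ scale d.
Proof. exact: trunc_log_bounds. Qed.

Lemma scale_succ d : 0 < d -> scale d.+1 <= (scale d).+1.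
Proof.
move=> d0; have /andP[_ h] := scaleP d0; have /andP[h2 _] := scaleP (ltn0Sn d).
by rewrite ltnS -(leq_exp2l _ _ (ltnSn 1)); apply: leq_trans h2 h.
Qed.

Lemma scale_mono d n : d <= n -> scale d <= scale n.
Proof. by move=> dn; rewrite ltnS; apply: leq_trunc_log. Qed.

Lemma nloc_count_le d : nloc_count d <= d.+1 * d.+1.
Proof.
rewrite /nloc_count; apply: (@leq_trans (\sum_(x < d.+1) \sum_(y < d.+1) 1)).
  by apply: leq_sum => x _; apply: leq_sum => y _; apply: leq_b1.
by rewrite !sum_nat_const !card_ord muln1.
Qed.

Lemma sqr_bound s L : s <= L -> 2 <= L -> (3 * s + 2) ^ 2 <= 16 * (L * L).
Proof.
move=> sL L2; have -> : 16 * (L * L) = (4 * L) ^ 2 by rewrite expnMn mulnn.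
by rewrite leq_sqr; lia.
Qed.

(** The number of duplications that bring the dense blocker on [d] points up to [n] vertices. *)
Definition spare n d := n - (d + 2 + 3 * scale d).

(** Discrete continuity in [d]: the size reached by duplicating only vertex 1 starts below [t],
    grows by at most [4 * n] per step, and ends above [t]. At the first crossing the overshoot is
    small enough for [dense_hit]. *)
Lemma dense_range n t :
  let L := scale n in
  10 <= L -> 100 * (100 * (L * L)) <= n -> n * n < 16 * t ->
  2 * t + 100 * (100 * (n * L)) <= n * n ->
  exists B : {set edge n}, nk_blocker t B.
Proof.
move=> L L10 Ln tlo thi; apply: NNPP => nB.
pose K := 40 * 100.
(* At [d0] the size is well below [n * n / 16]. Up to [d1] there is room for the hubs and for the
   [K + 3 * s] duplications that [dense_hit] may need. *)
pose d0 := n %/ 64; pose d1 := n - (2 + K + 6 * L).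
have L1 : 1000 * (100 * L) <= n by nia.
pose lower d := nloc_count d + d * scale d.
pose under d := exists2 tau, lower d <= tau & tau + spare n d * d < t.
have H i : d0 + i <= d1 -> under (d0 + i).
  have base d : d0 <= d -> d <= d1 -> [/\ 0 < d, n <= 128 * d, scale d <= L, 2 < scale d
      & 2 ^ (scale d).-1 <= d < 2 ^ scale d].
    move=> dd0 dd1; have dpos : 0 < d by rewrite /d0 in dd0; lia.
    have n128 : n <= 128 * d by rewrite /d0 in dd0; lia.
    split => //; [| |exact: scaleP].
      by apply: scale_mono; rewrite /d1 in dd1; lia.
    by rewrite /scale ltnS; apply: trunc_log_max => //; rewrite -[2 ^ 2]/4; lia.
  elim: i => [|i IH] h.
    rewrite addn0 in h *; have [dp _ SL S2 /dense_conf] := base d0 (leqnn _) h.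
    case/(_ (ltnW (ltnW S2))) => tau /andP[t1 t2] _.
    exists tau => //; have := nloc_count_le d0; move: t2; rewrite /spare.
    move: (scale d0) SL => S SL; move: (nloc_count d0) => c.
    have dn : 64 * d0 <= n by rewrite /d0; lia.
    have b1 : (3 * S + 2) ^ 2 <= 16 * (L * L) by apply: sqr_bound => //; lia.
    have b2 : d0 * S <= d0 * L by rewrite leq_mul2l SL orbT.
    have b3 : (n - (d0 + 2 + 3 * S)) * d0 <= n * d0 by rewrite leq_mul2r leq_subr orbT.
    have b4 : 64 * (n * d0) <= n * n by nia.
    have b5 : 64 * (d0.+1 * d0.+1) <= n * n by nia.
    have b6 : 64 * (d0 * L) <= n * n by nia.
    have b7 : 64 * (16 * (L * L)) <= n * n.
      by apply: (@leq_trans n); [lia|rewrite leq_pmulr //; lia].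
    lia.
  rewrite addnS in h *; have hd := ltnW h; have [tau tl tt] := IH hd.
  set d := d0 + i in h hd tl tt *.
  have [dp n128 SL S2 dS] := base d (leq_addr _ _) hd.
  have [dp' n128' SL' S2' dS'] := base d.+1 (leqW (leq_addr _ _)) h.
  have SS : scale d <= scale d.+1 by apply: scale_mono.
  have [tau' /andP[t1 t2] cf] := dense_conf dS' (ltnW (ltnW S2')).
  exists tau' => //; rewrite ltnNge; apply/negP => tge; apply: nB.
  have SS' := scale_succ dp; have cs := nloc_count_succ d.
  move: tge tt tl; rewrite /spare /lower.
  case: (scale d.+1) S2' dS' SS SS' SL' t1 t2 cf => [|[|s]] //= S2' dS' SS SS' SL' t1 t2 cf.
  move: (scale d) SL SS SS' => S SL SS SS' tge tt tl.
  have dn : d.+1 <= n by rewrite /d1 in h; lia.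
  apply: (dense_hit (K := K) dS' _ cf) => //; first by rewrite /d1 in h; lia.
  rewrite tge /=.
  have b1 : (3 * s.+2 + 2) ^ 2 <= 16 * (L * L) by apply: sqr_bound => //; lia.
  have b2 : (n - (d.+1 + 2 + 3 * s.+2)) * d.+1 <= (n - (d + 2 + 3 * S)) * d + n.
    rewrite mulnS addnC leq_add //; last by lia.
    by rewrite leq_mul2r; apply/orP; right; lia.
  have b3 : d.+1 * s.+2 <= d * S + d + s.+2.
    by rewrite mulSn addnC leq_add2r -mulnSr leq_mul2l SS' orbT.
  (* Since [n <= 128 * d] and [d.+1 < 2 ^ s.+2], [gap s] is nearly [n / 256] or more; [K] leaves
     ample slack. *)
  have b4 : 4 * n <= K * gap s.
    rewrite /gap; case/andP: dS' => _; rewrite expnS; set p := 2 ^ s.+1 => pd.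
    by rewrite /K; lia.
  have b5 : 16 * (L * L) <= n by lia.
  lia.
have d01 : d0 <= d1 by rewrite /d0 /d1 /K; lia.
(* At [d1] the unjoined pairs of points alone already number at least [t], contradicting
   [under d1]. *)
have := H (d1 - d0); rewrite subnKC // => /(_ (leqnn _)) [tau]; rewrite /lower => t1 t2.
have dn : d1 <= n by apply: leq_subr.
have d1p : 0 < d1 by rewrite /d1 /K; lia.
have SL : scale d1 <= L by apply: scale_mono.
have /andP[_ /nloc_count_ge] := scaleP d1p.
have b1 : 4 * d1.+1 * scale d1 <= 4 * (n * L) + 4 * L.
  have : d1.+1 * scale d1 <= n.+1 * L by apply: leq_mul.
  by move: (scale d1) => S; lia.
have b2 : n * n <= d1 * d1.-1 + n * (2 * (2 + K + 6 * L) + 1).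
  have -> : n = d1 + (2 + K + 6 * L) by rewrite /d1 /K; lia.
  by move: d1 (2 + K + 6 * L) {H d01 t1 t2 dn d1p SL b1} => [|d] c; rewrite /=; lia.
have b3 : n * (2 * (2 + K + 6 * L) + 1) + 4 * (n * L) + 4 * L <= 100 * (90 * (n * L)).
  have : n * 10 <= n * L by rewrite leq_mul2l L10 orbT.
  by rewrite /K; lia.
lia.
Qed.

(** * Thresholds and the natural logarithm *)

Lemma scale_small : exists n0, forall n, n0 < n ->
  10 <= scale n /\ 100 * (100 * (scale n * scale n)) <= n.
Proof.
exists (2 ^ 40) => n n40; have n0 : 0 < n by apply: leq_ltn_trans n40.
have /andP[h1 _] := scaleP n0.
have L40 : 40 <= (scale n).-1 := trunc_log_max (ltnSn 1) (ltnW n40).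
clear n40; move: L40 h1; rewrite /scale succnK; move: (trunc_log 2 n) => L L40 h1.
split; first by rewrite ltnS; apply: leq_trans L40.
(* With [p = 2 ^ m], [L.+1] is at most [4 * p] and [p ^ 4] at most [2 ^ L], so it suffices that
   [10000 * 16 = 400 ^ 2] is at most [p ^ 2]. *)
apply: leq_trans h1; pose m := L %/ 4.
have m10 : 10 <= m by rewrite /m; lia.
have lm : m < 2 ^ m := ltn_expl m (ltnSn 1).
have le1 : L.+1 <= 4 * 2 ^ m.
  by apply: (@leq_trans (4 * m.+1)); [rewrite /m; lia|rewrite leq_mul2l].
have e4 : 2 ^ m * 2 ^ m * (2 ^ m * 2 ^ m) <= 2 ^ L.
  by rewrite -!expnD leq_exp2l // /m; lia.
have big : 400 <= 2 ^ m.
  by apply: (@leq_trans (2 ^ 9)) => //; rewrite leq_exp2l //; lia.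
apply: leq_trans e4; move: (2 ^ m) le1 big => p le1 big.
have : L.+1 * L.+1 <= 4 * p * (4 * p) by apply: leq_mul.
have : 400 * 400 <= p * p by apply: leq_mul.
move: (L.+1 * L.+1) => l q1 q2.
have q3 : 100 * (100 * l) <= 400 * 400 * (p * p) by lia.
by apply: leq_trans q3 _; rewrite leq_mul2r q1 orbT.
Qed.

Lemma ln_le x y : (0 < x)%R -> (x <= y)%R -> (ln x <= ln y)%R.
Proof. by move=> x0 [/(ln_increasing _ _ x0)|->]; [apply: Rlt_le|apply: Rle_refl]. Qed.

(** From [ln 2 > 1/2], the binary logarithm is at most [2 * ln n]; the additional 1 is at most
    [ln n] because [n] is at least 4. *)
Lemma scale_ln n : 3 < n -> (INR (scale n) <= 3 * ln (INR n))%R.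
Proof.
move=> n3; have n0 : 0 < n by lia.
have /andP[h _] := scaleP n0; rewrite /scale S_INR; move: h; rewrite /scale /=.
move: (trunc_log 2 n) => k h.
have hn : (4 <= INR n)%R.
  by have := le_INR 4 n ltac:(lia); rewrite /=; lra.
have hk : (INR k * ln 2 <= ln (INR n))%R.
  rewrite -ln_pow; last lra.
  have -> : (2 ^ k)%R = INR (2 ^ k).
    by elim: (k) => [|j IH] //=; rewrite expnS mult_INR IH.
  by apply: ln_le; [apply: lt_0_INR; have := expn_gt0 2 k; lia|apply: le_INR; lia].
have l2 := ln_lt_2.
have h1 : (INR k * / 2 <= INR k * ln 2)%R by apply: Rmult_le_compat_l; [apply: pos_INR|lra].
have h2 : (2 * ln 2 <= ln (INR n))%R.
  have -> : (2 * ln 2 = ln 4)%R.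
    rewrite (_ : 4 = 2 * 2)%R; last lra.
    by rewrite ln_mult; lra.
  by apply: ln_le; lra.
lra.
Qed.

(** The constant 15000 is half of [10000 * 3], with the 3 from [scale_ln]. *)
Lemma upper_range n t : 3 < n ->
  (INR t <= INR n ^ 2 / 2 - 15000 * INR n * ln (INR n))%R ->
  2 * t + 100 * (100 * (n * scale n)) <= n * n.
Proof.
move=> n3 h; have hl := scale_ln n3.
apply/leP; apply: INR_le; rewrite plus_INR !mult_INR.
have e100 : INR 100 = 100%R by rewrite INR_IZR_INZ.
rewrite e100 (_ : INR 2 = 2%R) //.
have n0 : (0 <= INR n)%R := pos_INR n.
have : (INR n * INR (scale n) <= INR n * (3 * ln (INR n)))%R by apply: Rmult_le_compat_l.
lra.
Qed.

Theorem theorem1p3 :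
  exists (C : R) (n0 : nat), (0 < C)%R /\
    forall n t : nat, (n0 < n)%N -> (n - 2 <= t)%N ->
      (INR t <= INR n ^ 2 / 2 - C * INR n * ln (INR n))%R ->
      exists B : {set edge n}, @nk_blocker n t B.
Proof.
have [n0 n0P] := scale_small; exists 15000%R, (n0 + 100); split; first lra.
move=> n t nn0 lo hi; have [L10 Ln] := n0P n ltac:(lia).
have n3 : 3 < n by lia.
have [sm|lg] := leqP (16 * t) (n * n).
  by apply: sparse_range => //; lia.
exact: dense_range L10 Ln lg (upper_range n3 hi).
Qed.
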